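(* Let $N,k$ be positive integers with $N\ge 2k+1$, let $G$ be a connected $r$-regular graph on $m$ vertices, and let $X=C_N^k\square G$. For each $\alpha=1,\ldots,t$, assume that all roots of $D_{k,\nu_\alpha}(x)$ are simple. Then, for $a\in V(G)$ and $1\le\ell\le N-1$, we have $$F_X((0,a)\mid(\ell,a))=\frac{\tau(X)}{Nmk}h_{C_N^k}(0,\ell)-\tau(X)\sum_{\alpha=1}^{t}E_\alpha(a,a)\sum_{c=1}^{k}\frac{1}{\gamma_{\alpha,c}D_{k,\nu_\alpha}'(\phi_{\alpha,c})}\frac{V_\ell^{(\alpha,c)}V_{N-\ell}^{(\alpha,c)}}{V_N^{(\alpha,c)}}.$$
   Context: All graphs are finite, simple and undirected; $\mathbb Z_N=\mathbb Z/N\mathbb Z$. $C_N^k$ is the graph with vertex set $\mathbb Z_N$ in which $x,y$ are adjacent iff $x-y\equiv\pm s\pmod N$ for some $1\le s\le k$ (it is $2k$-regular since $N\ge 2k+1$). $X=C_N^k\square G$ is the Cartesian product: vertex set $\mathbb Z_N\times V(G)$, with $(x,a)$ and $(y,b)$ adjacent iff ($a=b$ and $x,y$ are adjacent in $C_N^k$) or ($x=y$ and $a,b$ are adjacent in $G$). For a finite connected graph $Y$ and $u,v\in V(Y)$, $h_Y(u,v)$ is the expected value of $T_v=\inf\{t\ge 0: Z_t=v\}$ for the simple random walk $(Z_t)$ on $Y$ started at $u$ (each step moves to a uniformly random neighbour). $\tau(X)$ is the number of spanning trees of $X$. For distinct vertices $x,y$, $F_X(x\mid y)$ is the number of spanning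 forests of $X$ with exactly two connected components in which $x$ and $y$ belong to different components. $L_G=rI_m-A_G$ is the Laplacian of $G$, with distinct eigenvalues $0=\nu_0<\nu_1<\cdots<\nu_t$; $E_\alpha$ is the orthogonal projection onto the $\nu_\alpha$-eigenspace, with entries $E_\alpha(a,b)$. For $\nu>0$, $D_{k,\nu}(x)=k+\frac{\nu}{2}-\sum_{s=1}^{k}T_s\left(\frac{x}{2}\right)$, where $T_s$ is the Chebyshev polynomial of the first kind; it has degree $k$. When the roots of $D_{k,\nu_\alpha}$ are simple they are denoted $\phi_{\alpha,1},\ldots,\phi_{\alpha,k}\in\mathbb C$. For each $\alpha\in\{1,\ldots,t\}$ and $c\in\{1,\ldots,k\}$ choose $\rho_{\alpha,c}\in\mathbb C$ with $\rho_{\alpha,c}+\rho_{\alpha,c}^{-1}=\phi_{\alpha,c}$, choose $\eta_{\alpha,c}\in\mathbb C$ with $\eta_{\alpha,c}^2=\rho_{\alpha,c}$, and put $\gamma_{\alpha,c}=\eta_{\alpha,c}+\eta_{\alpha,c}^{-1}$. The sequence $(V_n^{(\alpha,c)})_{n\ge 0}$ is defined by $V_0^{(\alpha,c)}=0$, $V_1^{(\alpha,c)}=1$, $V_{n+2}^{(\alpha,c)}=\gamma_{\alpha,c}V_{n+1}^{(\alpha,c)}-V_n^{(\alpha,c)}$. *)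

(* Defs.v *)
From HB Require Import structures.
From mathcomp Require Import all_boot all_order all_algebra.
From mathcomp Require Import all_classical all_reals all_analysis.
From mathcomp.real_closed Require Import complex.

Set Implicit Arguments.
Unset Strict Implicit.
Unset Printing Implicit Defensive.

Import Order.TTheory GRing.Theory Num.Theory.
Local Open Scope classical_set_scope.
Local Open Scope ring_scope.

(* A simple graph on a finite type is a symmetric irreflexive relation [e]. *)

Definition connected_graph (V : finType) (e : rel V) : Prop :=
  forall x y : V, connect e x y.

Definition degree (V : finType) (e : rel V) (x : V) : nat := #|[pred y | e x y]|.

Definition regular_graph (V : finType) (e : rel V) (r : nat) : Prop :=
  forall x : V, degree e x = r.

(* The graph C_N^k; only meaningful for N >= 2, since 'Z_N has at least two
   elements. *)
Definition circ_graph (N k : nat) : rel 'Z_N :=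
  [rel x y | [exists s : 'I_k, (x - y == s.+1%:R) || (x - y == - s.+1%:R)]].
Arguments circ_graph N k : clear implicits.

Definition cart_prod (U V : finType) (e : rel U) (f : rel V) : rel (U * V) :=
  [rel p q | (p.2 == q.2) && e p.1 q.1 || (p.1 == q.1) && f p.2 q.2].

Definition edges (V : finType) (e : rel V) : {set {set V}} :=
  [set A : {set V} | [exists p : V * V, e p.1 p.2 && (A == [set p.1; p.2]%SET)]]%SET.

(* The adjacency of the spanning subgraph (V, F). *)
Definition adj_of (V : finType) (F : {set {set V}}) : rel V :=
  [rel x y | [set x; y]%SET \in F].

(* No cycle of length at least 3; closed walks x, y, x are not cycles. *)
Definition acyclic (V : finType) (e : rel V) : Prop :=
  forall c : seq V, (2 < size c)%N -> ~ ucycle e c.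

Definition is_spanning_forest (V : finType) (e : rel V) (F : {set {set V}}) : Prop :=
  F \subset edges e /\ acyclic (adj_of F).

Definition is_spanning_tree (V : finType) (e : rel V) (F : {set {set V}}) : Prop :=
  is_spanning_forest e F /\ connected_graph (adj_of F).

Definition num_spanning_trees (V : finType) (e : rel V) : nat :=
  #|[set F : {set {set V}} | `[< is_spanning_tree e F >]]%SET|.

Definition num_separating_2forests (V : finType) (e : rel V) (x y : V) : nat :=
  #|[set F : {set {set V}} |
      `[< [/\ is_spanning_forest e F, n_comp (adj_of F) predT = 2%N
            & ~~ connect (adj_of F) x y] >]]%SET|.

Definition srw_step (R : realType) (V : finType) (e : rel V) (x y : V) : R :=
  (e x y)%:R / (degree e x)%:R.

(* [Z] is a simple random walk on [e] started at [u]; the last clause is the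
   Markov property with the conditional probabilities multiplied out. *)
Definition simple_random_walk (R : realType) (d : measure_display)
    (Omega : measurableType d) (P : probability Omega R)
    (V : finType) (e : rel V) (u : V) (Z : nat -> Omega -> V) : Prop :=
  [/\ forall n v, measurable (Z n @^-1` [set v]),
      P (Z 0%N @^-1` [set u]) = 1%E
    & forall (n : nat) (z : nat -> V),
        P [set w | forall i, (i <= n.+1)%N -> Z i w = z i] =
        (P [set w | forall i, (i <= n)%N -> Z i w = z i]
           * (srw_step R e (z n) (z n.+1))%:E)%E].

(* The infimum of the empty set is +oo, the value when [v] is never hit. *)
Definition hitting_time (R : realType) (Omega : Type) (V : finType)
    (Z : nat -> Omega -> V) (v : V) (w : Omega) : \bar R :=
  ereal_inf [set n%:R%:E | n in [set n : nat | Z n w = v]].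

Definition expected_hitting_time (R : realType) (d : measure_display)
    (Omega : measurableType d) (P : probability Omega R)
    (V : finType) (Z : nat -> Omega -> V) (v : V) : \bar R :=
  (\int[P]_w hitting_time R Z v w)%E.

(* Vertices are numbered by [enum_val]/[enum_rank]. *)
Definition adj_mx (R : nzRingType) (V : finType) (e : rel V) : 'M[R]_#|V| :=
  \matrix_(i, j) (e (enum_val i) (enum_val j))%:R.

Definition laplacian (R : nzRingType) (V : finType) (e : rel V) (r : nat) :
    'M[R]_#|V| :=
  (r%:R)%:M - adj_mx R e.

(* Orthogonal projection onto the a-eigenspace: the row space of
   [kermx U^T] is the orthogonal complement of the row space of [U]. *)
Definition eigenproj (R : fieldType) (n : nat) (A : 'M[R]_n) (a : R) : 'M[R]_n :=
  proj_mx (eigenspace A a) (kermx (eigenspace A a)^T).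

Fixpoint chebyshevT (R : nzRingType) (n : nat) : {poly R} :=
  match n with
  | 0 => 1
  | n'.+1 => match n' with
             | 0 => 'X
             | n''.+1 => 'X * chebyshevT R n' *+ 2 - chebyshevT R n''
             end
  end.

Definition Dpoly (C : fieldType) (k : nat) (nu : C) : {poly C} :=
  (k%:R + nu / 2)%:P - \sum_(1 <= s < k.+1) (chebyshevT C s \Po (2^-1 *: 'X)).

Definition simple_roots (C : fieldType) (p : {poly C}) : Prop :=
  forall z : C, root p z -> mup z p = 1%N.

Fixpoint Vseq (C : nzRingType) (g : C) (n : nat) : C :=
  match n with
  | 0 => 0
  | n'.+1 => match n' with
             | 0 => 1
             | n''.+1 => g * Vseq g n' - Vseq g n''
             end
  end.

(* Main.v *)
Require Import Defs.
From HB Require Import structures.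
From mathcomp Require Import all_boot all_order all_algebra.
From mathcomp Require Import all_classical all_reals all_analysis.
From mathcomp.real_closed Require Import complex.
From mathcomp Require Import measurable_realfun ring zify.

Set Implicit Arguments.
Unset Strict Implicit.
Unset Printing Implicit Defensive.

Import Order.TTheory GRing.Theory Num.Theory.
Local Open Scope ring_scope.

(* For fixed x, y in a graph with Laplacian L, let c(u) be the number of
   two-component spanning forests separating x from y with u on the side of x.
   Adding an edge uv to such a forest with u, v on different sides gives a tree
   whose x-y path crosses uv, and counting these crossings tree by tree gives
   L c = tau (delta_x - delta_y).  Pairing c with any f such that
   L f = delta_x - delta_y yields F(x | y) = c(x) - c(y) = tau (f x - f y), as L
   is symmetric.

   On C_N^k [] G such an f is the sum over alpha of E_alpha(a, b) p_alpha(x), with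
   (L_C + nu_alpha) p_alpha = delta_0 - delta_l.  For nu_alpha > 0,
   L_C + nu_alpha = 2 D(S + S^-1) with S the cyclic shift; partial fractions reduce
   its inverse to the Green functions (S + S^-1 - phi)^-1 of the cycle, which are
   explicit in rho and whose increments are the quotients V_l V_(N-l) / V_N.
   No denominator vanishes, because D > 0 on [-2, 2].  For alpha = 0 the potential is,
   up to a constant, a hitting-time function: a nonnegative h vanishing at v with
   h = 1 + (average of h over the neighbours) elsewhere is the expected hitting
   time of v, since the sums of P(T_v > n) telescope against E[h(Z_n); T_v > n]. *)

(** * Spanning forests as edge sets *)

Section EdgeSets.
Variable V : finType.
Implicit Types (F G : {set {set V}}) (u v x y z : V).

Lemma eq_set2P u v x y :
  ([set x; y] = [set u; v])%SET -> (x = u /\ y = v) \/ (x = v /\ y = u).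
Proof.
move=> E.
have xuv : (x \in [set u; v])%SET by rewrite -E set21.
have yuv : (y \in [set u; v])%SET by rewrite -E set22.
have uxy : (u \in [set x; y])%SET by rewrite E set21.
have vxy : (v \in [set x; y])%SET by rewrite E set22.
move: xuv yuv uxy vxy; rewrite !inE.
by do 4!case/orP=> /eqP ?; subst; auto.
Qed.

Lemma adj_ofE F x y : adj_of F x y = ([set x; y]%SET \in F).
Proof. by []. Qed.

Lemma adj_of_sym F : symmetric (adj_of F).
Proof. by move=> x y; rewrite /adj_of /= finset.setUC. Qed.

Lemma connect_adj_sym F : connect_sym (adj_of F).
Proof. exact: sym_connect_sym (adj_of_sym F). Qed.

Lemma connect_adj_sub F G x y :
  F \subset G -> connect (adj_of F) x y -> connect (adj_of G) x y.
Proof.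
by move=> /fintype.subsetP sFG; apply: connect_sub => a b /= Fab; apply/connect1/sFG.
Qed.

Lemma connect_edge F x y : ([set x; y]%SET \in F) -> connect (adj_of F) x y.
Proof. by move=> ?; apply: connect1. Qed.

Lemma connect_adj_ind F (Q : V -> Prop) x y :
    Q x -> (forall b c, connect (adj_of F) x b -> Q b -> [set b; c]%SET \in F -> Q c) ->
  connect (adj_of F) x y -> Q y.
Proof.
move=> Qx step /connectP[p]; elim/last_ind: p y => [|p c IHp] y /= Hp -> //.
rewrite last_rcons; move: Hp; rewrite rcons_path => /andP[Hp Fc].
apply: (step (last x p)) => //; last exact: IHp.
by apply/connectP; exists p.
Qed.

(** The three alternatives are stable under appending an edge to the walk: crossing [uv] moves
    between them, and a crossing back undoes the earlier one. *)
Lemma connect_addE F u v x y :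
  connect (adj_of ([set u; v] |: F)%SET) x y ->
  [\/ connect (adj_of F) x y,
      connect (adj_of F) x u /\ connect (adj_of F) v y |
      connect (adj_of F) x v /\ connect (adj_of F) u y].
Proof.
pose Q z := [\/ connect (adj_of F) x z,
  connect (adj_of F) x u /\ connect (adj_of F) v z |
  connect (adj_of F) x v /\ connect (adj_of F) u z].
apply: (connect_adj_ind (Q := Q)) => [|b c _ IH]; first by constructor 1.
rewrite finset.in_setU1 => /orP[/eqP/eq_set2P[] [Eb Ec]|Fbc]; subst.
- by case: IH => [H|[H _]|[H _]]; [constructor 2|constructor 2|constructor 1].
- by case: IH => [H|[H _]|[H _]]; [constructor 3|constructor 1|constructor 3].
- have bc := connect_edge Fbc.
  case: IH => [H|[H H']|[H H']]; [constructor 1|constructor 2|constructor 3];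
    by [exact: connect_trans bc|split=> //; exact: connect_trans bc].
Qed.

(** A simple path from [u] to [v] that avoids the edge [uv] would close up with it to a cycle. *)
Lemma acyclic_bridge F u v : acyclic (adj_of F) -> u != v ->
  [set u; v]%SET \in F -> ~~ connect (adj_of (F :\ [set u; v])%SET) u v.
Proof.
move=> acF uv Fuv; apply/negP => /connectP[p /shortenP[q]].
move=> Hq Uq _ Ev.
apply: (acF (u :: q)).
  (* The cycle has at least 3 vertices: an empty path contradicts [u != v], and a one-edge path
     would be the deleted edge. *)
  case: q Hq Uq Ev => [|w [|w' q]] //=; first by move=> _ _ E; rewrite E eqxx in uv.
  by move=> /andP[H _] _ E; move: H; rewrite -E adj_ofE !inE eqxx.
rewrite /ucycle Uq andbT /= rcons_path -Ev adj_of_sym [X in _ && X]Fuv andbT.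
by apply: sub_path Hq => a b; rewrite !adj_ofE finset.in_setD1 => /andP[].
Qed.

(** Every edge of the path starts at a vertex other than [x] and [y], so none of them is [xy]. *)
Lemma path_avoid F x y z q : x \notin z :: q -> y \notin z :: q ->
  path (adj_of F) z (rcons q x) -> connect (adj_of (F :\ [set x; y])%SET) z x.
Proof.
elim: q z => [|w q IHq] z xq yq /=.
  rewrite andbT => Fzx; apply: connect_edge; rewrite finset.in_setD1 -(adj_ofE F) Fzx andbT.
  apply/eqP => /eq_set2P[] [E _]; first by rewrite E mem_seq1 eqxx in xq.
  by rewrite E mem_seq1 eqxx in yq.
rewrite in_cons negb_or in xq; rewrite in_cons negb_or in yq.
case/andP: xq => xz xq; case/andP: yq => yz yq.
move=> /andP[Fzw Hq]; apply: connect_trans (IHq w xq yq Hq).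
apply: connect_edge; rewrite finset.in_setD1 -(adj_ofE F) Fzw andbT.
by apply/eqP => /eq_set2P[] [E _]; [rewrite E eqxx in xz|rewrite E eqxx in yz].
Qed.

(** In a cycle [x], [y], [z], ..., the edge [yz] followed by the arc from [z] back to [x] joins the
    ends of [xy] without using it. *)
Lemma bridge_acyclic F :
  (forall u v, [set u; v]%SET \in F -> ~~ connect (adj_of (F :\ [set u; v])%SET) u v) ->
  acyclic (adj_of F).
Proof.
move=> br [|x [|y [|z q]]] //= _ /andP[/= /and3P[Fxy Fyz Hq]].
rewrite !inE !negb_or => /and3P[/and3P[xy xz xq] /andP[yz yq] _].
have := br _ _ Fxy; rewrite connect_adj_sym => /negP; apply.
apply: (@connect_trans _ _ z).
  apply: connect_edge; rewrite finset.in_setD1 -(adj_ofE F) Fyz andbT.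
  by apply/eqP => /eq_set2P[] [E E']; [rewrite E eqxx in xy|rewrite E' eqxx in xz].
by apply: (path_avoid (q := q)) => //; rewrite in_cons negb_or ?xz ?yz.
Qed.

Lemma setU1_setD1 F u v : [set u; v]%SET \in F ->
  ([set u; v] |: (F :\ [set u; v]))%SET = F.
Proof. exact: finset.setD1K. Qed.

Lemma acyclic_sub F G : F \subset G -> acyclic (adj_of G) -> acyclic (adj_of F).
Proof.
move=> /fintype.subsetP sFG acG c c2 /andP[cy U]; apply: (acG c c2); rewrite /ucycle U andbT.
case: c c2 cy U => //= x p _ Hp _; apply: sub_path Hp => a b /=; exact: sFG.
Qed.

(** By the bridge criterion: if the ends of another edge [ab] stayed joined without it, this would
    be through [uv], and then [ab] would join [u] to [v] within [F]. A singleton in [F] would be a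
    loop, which [acyclic] does not exclude. *)
Lemma acyclic_add F u v : acyclic (adj_of F) -> (forall w, [set w] \notin F)%SET ->
  ~~ connect (adj_of F) u v -> acyclic (adj_of ([set u; v] |: F)%SET).
Proof.
move=> acF irrF nuv; apply: bridge_acyclic => a b.
have Fuv : [set u; v]%SET \notin F.
  by apply: contra nuv; exact: connect_edge.
have [E _|ne] := eqVneq ([set a; b])%SET ([set u; v])%SET.
  rewrite E setU1K //.
  case: (eq_set2P E) => [] [-> ->] //.
  by rewrite connect_adj_sym.
rewrite !inE (negbTE ne) /= => Fab.
have ab : a != b by apply: contraTneq Fab => ->; rewrite finset.setUid.
have br := acyclic_bridge acF ab Fab.
have -> : (([set u; v] |: F) :\ [set a; b])%SET = ([set u; v] |: (F :\ [set a; b]))%SET.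
  apply/setP => A; rewrite !inE; case: eqVneq => //= ->.
  by rewrite (negbTE ne).
have sF : (F :\ [set a; b])%SET \subset F by apply: subD1set.
apply/negP => /connect_addE[H|[H1 H2]|[H1 H2]]; first by rewrite H in br.
- case/negP: nuv; rewrite connect_adj_sym.
  apply: (connect_trans (connect_adj_sub sF H2)); rewrite connect_adj_sym.
  rewrite connect_adj_sym in H1.
  exact: connect_trans (connect_adj_sub sF H1) (connect_edge Fab).
- case/negP: nuv.
  apply: (connect_trans (connect_adj_sub sF H2)); rewrite connect_adj_sym.
  rewrite connect_adj_sym in H1.
  exact: connect_trans (connect_adj_sub sF H1) (connect_edge Fab).
Qed.

(** Components are counted by their canonical roots. Those of [a] and [b] already give two, so the
    count is 2 exactly when there is no other root. *)
Lemma n_comp2P F a b : ~~ connect (adj_of F) a b ->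
  reflect (forall z, connect (adj_of F) z a || connect (adj_of F) z b)
          (n_comp (adj_of F) predT == 2%N).
Proof.
move=> nab; have sc := connect_adj_sym F.
have rab : fingraph.root (adj_of F) a != fingraph.root (adj_of F) b by rewrite (root_connect sc).
have -> : n_comp (adj_of F) predT = #|roots (adj_of F)|.
  by apply: eq_card => z; rewrite !inE andbT.
have sub2 : [set fingraph.root (adj_of F) a; fingraph.root (adj_of F) b]%SET
    \subset roots (adj_of F).
  by apply/fintype.subsetP => z; rewrite !inE => /orP[] /eqP->; apply: roots_root.
have c2 : #|[set fingraph.root (adj_of F) a; fingraph.root (adj_of F) b]%SET| = 2%N.
  by rewrite cards2 rab.
apply: (iffP eqP) => [c2' z|H].
  have: fingraph.root (adj_of F) z \in roots (adj_of F) by apply: roots_root.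
  rewrite -(subset_cardP _ sub2) ?c2 ?c2' // !inE.
  by rewrite !(root_connect sc).
rewrite -c2; apply: eq_card => z; apply/idP/idP => [/eqP rz|]; last exact: (fintype.subsetP sub2).
by rewrite !inE; have := H z; rewrite -!(root_connect sc) rz.
Qed.

Lemma setD1_setU1 F u v : ~~ connect (adj_of F) u v ->
  (([set u; v] |: F) :\ [set u; v])%SET = F.
Proof. by move=> nuv; rewrite setU1K //; apply: contra nuv; apply: connect_edge. Qed.

(** For [u != z] the only such [v] is the first vertex after [u] on the tree path to [z]; for
    [u = z] such a [v] would contradict that [uv] is a bridge. *)
Lemma tree_branch F u z : acyclic (adj_of F) -> (forall w, [set w] \notin F)%SET ->
    connected_graph (adj_of F) ->
  #|[pred v | ([set u; v]%SET \in F) && connect (adj_of (F :\ [set u; v])%SET) v z]|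
  = (u != z).
Proof.
move=> acF irrF cF; set S := [pred v | _].
have neq v : [set u; v]%SET \in F -> u != v.
  by apply: contraTneq => <-; rewrite finset.setUid.
have [E|uz] := eqVneq u z; first subst z.
  apply: eq_card0 => v; rewrite !inE; apply/negbTE/negP => /andP[Fuv].
  by rewrite connect_adj_sym (negbTE (acyclic_bridge acF (neq _ Fuv) Fuv)).
suff [v Sv uniqS] : exists2 v, v \in S & forall w, w \in S -> w = v.
  rewrite [RHS]/= -(card1 v); apply: eq_card => w; rewrite [in RHS]inE.
  by apply/idP/eqP => [/uniqS|->].
(* Existence: along a walk from [u] to [z], keep the branch at [u] that contains the current vertex,
   choosing a new one each time the walk leaves [u]. *)
pose Q w := w = u \/ exists v, v \in [pred v | ([set u; v]%SET \in F) &&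
  connect (adj_of (F :\ [set u; v])%SET) v w].
have: Q z.
  apply: (connect_adj_ind (Q := Q) _ _ (cF u z)) => [|b c _ IH Fbc]; first by left.
  have [->|cu] := eqVneq c u; first by left.
  right; have [Eb|bu] := eqVneq b u.
    by exists c; rewrite inE -Eb Fbc connect0.
  case: IH => [/eqP|[v]]; first by rewrite (negbTE bu).
  rewrite inE => /andP[Fuv vb]; exists v; rewrite inE Fuv /=.
  apply: connect_trans vb (connect_edge _).
  rewrite finset.in_setD1 Fbc andbT; apply/eqP => /eq_set2P[] [E1 E2].
    by rewrite E1 eqxx in bu.
  by rewrite E2 eqxx in cu.
case=> [/eqP|[v Sv]]; first by rewrite eq_sym (negbTE uz).
exists v => // w Sw.
move: Sv Sw; rewrite !inE => /andP[Fuv vz] /andP[Fuw wz].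
apply/eqP/negPn/negP => wv.
have uv_uw : [set u; v]%SET != [set u; w]%SET.
  apply/eqP => /eq_set2P[] [E1 E2]; first by rewrite E2 eqxx in wv.
  by rewrite E2 -E1 eqxx in wv.
have bv := acyclic_bridge acF (neq _ Fuv) Fuv.
have bw := acyclic_bridge acF (neq _ Fuw) Fuw.
(* Uniqueness: with both edges removed, [v] and [w] would still be joined through [z], and [uw]
   would then provide a way around [uv]. *)
pose K := (F :\ [set u; v] :\ [set u; w])%SET.
have Kv : K \subset (F :\ [set u; v])%SET by apply: subD1set.
have Kw : K \subset (F :\ [set u; w])%SET by rewrite finset.setSD // subD1set.
have vw : ~ connect (adj_of K) v w.
  move=> H; case/negP: bv; rewrite connect_adj_sym.
  apply: connect_trans (connect_adj_sub Kv H) _.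
  rewrite connect_adj_sym; apply: connect_edge.
  by rewrite finset.in_setD1 Fuw eq_sym uv_uw.
have Ev : (F :\ [set u; v] = [set u; w] |: K)%SET.
  by rewrite finset.setD1K // finset.in_setD1 Fuw eq_sym uv_uw.
have Ew : (F :\ [set u; w] = [set u; v] |: K)%SET.
  apply/setP => A; rewrite !inE.
  by have [->|] := eqVneq A [set u; v]%SET; rewrite ?Fuv ?uv_uw.
have vzK : connect (adj_of K) v z.
  move: vz; rewrite Ev => /connect_addE[//|[vu _]|[//]].
  by case/negP: bv; rewrite connect_adj_sym (connect_adj_sub Kv vu).
have wzK : connect (adj_of K) w z.
  move: wz; rewrite Ew => /connect_addE[//|[wu _]|[wv' _]].
    by case/negP: bw; rewrite connect_adj_sym (connect_adj_sub Kw wu).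
  by case: vw; rewrite connect_adj_sym.
by apply: vw; apply: connect_trans vzK _; rewrite connect_adj_sym.
Qed.

End EdgeSets.

(** * Two-component forests and electrical potentials *)

Section ForestCounting.
Variables (V : finType) (e : rel V).
Hypotheses (e_sym : symmetric e) (e_irr : irreflexive e).
Implicit Types (F : {set {set V}}) (u v x y z : V).

Lemma edge_mem u v : ([set u; v]%SET \in edges e) = e u v.
Proof.
rewrite inE; apply/existsP/idP => [[[a b] /= /andP[eab /eqP/eq_set2P[] [-> ->]]] //|euv].
  by rewrite e_sym.
by exists (u, v); rewrite /= euv eqxx.
Qed.

Lemma spanning_forest_irr F w : is_spanning_forest e F -> ([set w] \notin F)%SET.
Proof.
move=> [/fintype.subsetP sF _]; apply/negP => /sF.
by rewrite -[[set w]%SET]finset.setUid edge_mem e_irr.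
Qed.

Definition separating F x y : bool :=
  `[< [/\ is_spanning_forest e F, n_comp (adj_of F) predT = 2%N
        & ~~ connect (adj_of F) x y] >].

(** As [u] varies, the cardinality is the function whose Laplacian is tau times a difference of
    point masses. *)
Definition sep_forests x y u : {set {set {set V}}} :=
  [set F | separating F x y && connect (adj_of F) x u]%SET.

Definition tree F : bool := `[< is_spanning_tree e F >].

(** For a tree: the path from [x] to [y] traverses the edge [uv], in the direction from [u] to
    [v]. *)
Definition crossing x y u v F : bool :=
  [&& [set u; v]%SET \in F, connect (adj_of (F :\ [set u; v])%SET) x u
    & connect (adj_of (F :\ [set u; v])%SET) v y].

(** Adding [uv] is a bijection from these forests to these trees, with deletion of [uv] as its
    inverse. *)
Lemma card_sep_forestsD x y u v : e u v ->
  #|sep_forests x y u :\: sep_forests x y v|%SET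
  = #|[set F | tree F && crossing x y u v F]%SET|.
Proof.
move=> euv; have uv : u != v by apply: contraTneq euv => ->; rewrite e_irr.
have sepP F : F \in (sep_forests x y u :\: sep_forests x y v)%SET ->
    [/\ is_spanning_forest e F, forall z, connect (adj_of F) z x || connect (adj_of F) z y,
        ~~ connect (adj_of F) x y, connect (adj_of F) x u & ~~ connect (adj_of F) u v].
  rewrite !inE => /andP[nv /andP[sF xu]]; move: (sF) => /asboolP[fF c2 nxy].
  split=> //; first by apply/n_comp2P => //; apply/eqP.
  by apply: contra nv => /(connect_trans xu) ->; rewrite sF.
have <- : ((fun F => [set u; v] |: F) @: (sep_forests x y u :\: sep_forests x y v))%SET
    = [set F | tree F && crossing x y u v F]%SET.
  apply/setP => T; rewrite [RHS]inE; apply/imsetP/idP => [[F /sepP[fF H nxy xu nuv] ->{T}]|].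
    have vy : connect (adj_of F) v y.
      case/orP: (H v) => // vx; case/negP: nuv.
      by rewrite connect_adj_sym (connect_trans vx xu).
    have sU : F \subset ([set u; v] |: F)%SET by apply: finset.subsetUr.
    rewrite /crossing setD1_setU1 // xu vy setU11 !andbT; apply/asboolP; split; first split.
    - by case: fF => sF _; rewrite finset.subUset sF finset.sub1set edge_mem euv.
    - apply: acyclic_add => //; first by case: fF.
      by move=> w; exact: spanning_forest_irr.
    - have H' z : connect (adj_of ([set u; v] |: F)%SET) z x.
        have /orP[|] := H z; first exact: connect_adj_sub.
        move/(connect_adj_sub sU) => zy; apply: (connect_trans zy).
        rewrite connect_adj_sym; apply: connect_trans (connect_adj_sub sU xu) _.
        by apply: connect_trans (connect_adj_sub sU vy); apply/connect_edge/setU11.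
      by move=> a b; apply: connect_trans (H' a) _; rewrite connect_adj_sym.
  move=> /andP[/asboolP[[sT acT] cT] /and3P[Tuv xu vy]].
  set F := (T :\ [set u; v])%SET in xu vy.
  have ET : T = ([set u; v] |: F)%SET by rewrite finset.setD1K.
  have nuv : ~~ connect (adj_of F) u v by apply: acyclic_bridge.
  have nxv : ~~ connect (adj_of F) x v.
    by apply: contra nuv; apply: connect_trans; rewrite connect_adj_sym.
  have nxy : ~~ connect (adj_of F) x y.
    by apply: contra nxv => /connect_trans; apply; rewrite connect_adj_sym.
  have sFT : F \subset T by apply: subD1set.
  exists F => //; rewrite !inE xu (negbTE nxv) andbF andbT /=.
  apply/asboolP; split=> //.
    by split; [exact: fintype.subset_trans sFT sT|exact: acyclic_sub acT].
  apply/eqP/(n_comp2P nxy) => z; have := cT z u; rewrite {1}ET => /connect_addE.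
  rewrite connect_adj_sym in xu.
  case=> [zu|[zu _]|[zv _]]; first by rewrite (connect_trans zu xu).
    by rewrite (connect_trans zu xu).
  by rewrite (connect_trans zv vy) orbT.
rewrite card_in_imset // => F G /sepP[_ _ _ _ nF] /sepP[_ _ _ _ nG] E.
by rewrite -(setD1_setU1 nF) -(setD1_setU1 nG) E.
Qed.

Variable K : pzRingType.

(** Deleting [uv] from a tree leaves two sides, and each difference compares whether [y] and [x] lie
    on the side of [v]. The right-hand form separates [x] from [y], so that [tree_branch] applies to
    each term. *)
Lemma crossing_diff x y u v F : tree F ->
  (crossing x y u v F)%:R - (crossing x y v u F)%:R =
  (([set u; v]%SET \in F) && connect (adj_of (F :\ [set u; v])%SET) v y)%:R
  - (([set u; v]%SET \in F) && connect (adj_of (F :\ [set u; v])%SET) v x)%:R :> K.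
Proof.
move=> /asboolP[fF cF]; rewrite /crossing [([set v; u])%SET]finset.setUC.
have [Fuv|] /= := boolP ([set u; v]%SET \in F); last by rewrite !subrr.
have uv : u != v.
  apply: contraTneq Fuv => ->; rewrite finset.setUid; exact: spanning_forest_irr.
have nuv := acyclic_bridge (proj2 fF) uv Fuv.
set H := (F :\ [set u; v])%SET in nuv *.
have side z : connect (adj_of H) z u = ~~ connect (adj_of H) z v.
  have [zv|nzv] /= := boolP (connect (adj_of H) z v).
    by apply: contraNF nuv; rewrite connect_adj_sym => /connect_trans; apply.
  have := cF z u; rewrite -{1}(setU1_setD1 Fuv) => /connect_addE[|[]|[zv]] //.
  by rewrite zv in nzv.
rewrite ![connect _ u _]connect_adj_sym ![connect _ v _]connect_adj_sym !side.
by case: (connect _ x v); case: (connect _ y v); rewrite /= ?subr0 ?sub0r ?subrr.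
Qed.

Lemma laplacian_sep_forests x y u :
  \sum_(v | e u v) (#|sep_forests x y u|%:R - #|sep_forests x y v|%:R) =
  (num_spanning_trees e)%:R * ((u == x)%:R - (u == y)%:R) :> K.
Proof.
have step v : e u v -> #|sep_forests x y u|%:R - #|sep_forests x y v|%:R =
    \sum_(F | tree F) ((crossing x y u v F)%:R - (crossing x y v u F)%:R) :> K.
  move=> euv; have evu : e v u by rewrite e_sym.
  (* Forests with both [u] and [v] on the side of [x] cancel; the two set differences are crossings
     of [uv] in opposite directions. *)
  rewrite -(cardsID (sep_forests x y v) (sep_forests x y u)).
  rewrite -(cardsID (sep_forests x y u) (sep_forests x y v)) finset.setIC !natrD.
  rewrite opprD addrACA subrr add0r !card_sep_forestsD // sumrB.
  have E a b : #|[set F | tree F && crossing x y a b F]%SET|%:R =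
      \sum_(F | tree F) (crossing x y a b F)%:R :> K.
    rewrite -sum1_card natr_sum (eq_bigl (fun F => tree F && crossing x y a b F)).
      by rewrite big_mkcondr /=; apply: eq_bigr => F _; case: crossing.
    by move=> F; rewrite inE.
  by rewrite !E.
rewrite (eq_bigr _ step) exchange_big /=.
transitivity (\sum_(F | tree F) ((u == x)%:R - (u == y)%:R) : K).
  apply: eq_bigr => F tF; under eq_bigr do rewrite crossing_diff //.
  have /asboolP[fF cF] := tF.
  have count z : \sum_(v | e u v) (([set u; v]%SET \in F) &&
      connect (adj_of (F :\ [set u; v])%SET) v z)%:R = (u != z)%:R :> K.
    rewrite -(tree_branch u z (proj2 fF)) //; last first.
      by move=> w; exact: spanning_forest_irr.
    rewrite -sum1_card natr_sum big_mkcond [RHS]big_mkcond /=.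
    apply: eq_bigr => v _; rewrite [in RHS]inE.
    have [Fuv|_] /= := boolP ([set u; v]%SET \in F); last by case: ifP.
    have -> : e u v by rewrite -edge_mem; case: fF => /fintype.subsetP /(_ _ Fuv).
    by case: connect.
  rewrite sumrB !count; case: (u == x); case: (u == y);
    by rewrite /= ?subr0 ?sub0r ?subrr.
by rewrite sumr_const mulr_natl /num_spanning_trees cardsE.
Qed.

Lemma sum_laplacian_sym (f g : V -> K) :
  \sum_u f u * (\sum_(v | e u v) (g u - g v)) =
  \sum_u (\sum_(v | e u v) (f u - f v)) * g u.
Proof.
have E : \sum_u \sum_(v | e u v) f u * g v = \sum_u \sum_(v | e u v) f v * g u.
  rewrite (exchange_big_dep xpredT) //=; apply: eq_bigr => u _.
  by apply: eq_bigl => v; rewrite e_sym.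
under eq_bigr do rewrite mulr_sumr (eq_bigr _ (fun _ _ => mulrBr _ _ _)) sumrB.
rewrite sumrB E -sumrB; apply: eq_bigr => u _.
by rewrite -sumrB mulr_suml; apply: eq_bigr => v _; rewrite mulrBl.
Qed.

Lemma num_separating_2forests_potential x y (f : V -> K) :
    (forall u, \sum_(v | e u v) (f u - f v) = (u == x)%:R - (u == y)%:R) ->
  (num_separating_2forests e x y)%:R = (num_spanning_trees e)%:R * (f x - f y).
Proof.
move=> Lf; have := sum_laplacian_sym (fun u => #|sep_forests x y u|%:R) f.
under eq_bigr do rewrite Lf mulrBr.
under [in RHS]eq_bigr do rewrite laplacian_sep_forests -mulrA mulrBl.
have delta (h : V -> K) z : \sum_u h u * (u == z)%:R = h z.
  rewrite (bigD1 z) //= eqxx mulr1 big1 ?addr0 // => u /negbTE->.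
  by rewrite mulr0.
have delta' (h : V -> K) z : \sum_u (u == z)%:R * h u = h z.
  rewrite (bigD1 z) //= eqxx mul1r big1 ?addr0 // => u /negbTE->.
  by rewrite mul0r.
rewrite sumrB !delta -mulr_sumr sumrB !delta' => <-.
(* The function vanishes at [y] and counts all separating forests at [x]. *)
have -> : #|sep_forests x y y| = 0%N.
  apply: eq_card0 => F; rewrite !inE; apply/negbTE; rewrite negb_and.
  by have [/asboolP[_ _ ->]|] := boolP (separating F x y).
rewrite subr0; congr (_%:R); apply: eq_card => F.
by rewrite !inE connect0 andbT.
Qed.

End ForestCounting.

(** * Cartesian products, circulant graphs and the polynomials D *)

Section CartesianProduct.
Variables (U V : finType) (e : rel U) (f : rel V).
Hypothesis (f_irr : irreflexive f).

Lemma cart_prod_sym : symmetric e -> symmetric f -> symmetric (cart_prod e f).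
Proof.
move=> e_sym f_sym [x a] [y b].
by rewrite /cart_prod /= e_sym f_sym [a == b]eq_sym [x == y]eq_sym.
Qed.

Lemma cart_prod_irr : irreflexive e -> irreflexive (cart_prod e f).
Proof. by move=> e_irr [x a]; rewrite /cart_prod /= e_irr f_irr !andbF. Qed.

Lemma sum_cart_prod (K : nmodType) (F : U * V -> K) (x : U) (a : V) :
  \sum_(q | cart_prod e f (x, a) q) F q =
  \sum_(y | e x y) F (y, a) + \sum_(b | f a b) F (x, b).
Proof.
(* As [f] is irreflexive, a neighbour in the [V] direction has a new second coordinate, so this test
   tells the two kinds of neighbours apart. *)
rewrite (bigID (fun q : U * V => q.2 == a)) /=; congr (_ + _).
  rewrite (reindex_onto (fun y => (y, a)) fst) /=; last first.
    by move=> [y b] /= /andP[_ /eqP->].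
  by apply: eq_bigl => y; rewrite /cart_prod /= f_irr !eqxx !andbT andbF orbF.
rewrite (reindex_onto (fun b => (x, b)) snd) /=; last first.
  move=> [y b] /=; rewrite /cart_prod /= eq_sym => /andP[/orP[/andP[]|]].
    by rewrite eq_sym => ->.
  by case/andP => /eqP->.
apply: eq_bigl => b; rewrite /cart_prod /= !eqxx !andbT /=.
by have [->|_] /= := eqVneq a b; rewrite ?f_irr ?andbF ?eqxx //= ?andbT // eq_sym.
Qed.

End CartesianProduct.

(** * Neighbour sums, regularity and connectedness of the circulant graph *)

Section Circulant.
Variables (N k : nat).
Hypotheses (k_gt0 : (0 < k)%N) (N_ge : (k.*2.+1 <= N)%N).

Lemma circ_order_gt1 : (1 < N)%N.
Proof. by apply: leq_trans N_ge; rewrite -addnn; lia. Qed.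

Lemma Zp_nat_inj m n : (m < N)%N -> (n < N)%N ->
  m%:R = n%:R :> 'Z_N -> m = n.
Proof.
move=> mN nN /(congr1 (@nat_of_ord _)).
by rewrite !val_Zp_nat ?circ_order_gt1 // !modn_small.
Qed.

Lemma circ_graph_sym : symmetric (circ_graph N k).
Proof.
move=> x y; rewrite /circ_graph /=; apply: eq_existsb => s.
by rewrite -(opprB y x) eqr_opp orbC eqr_oppLR.
Qed.

Lemma circ_graph_irr : irreflexive (circ_graph N k).
Proof.
move=> x; rewrite /circ_graph /=; apply/existsP => -[s].
rewrite subrr eq_sym [0 == _]eq_sym oppr_eq0 orbb => /eqP H.
have sN : (s.+1 < N)%N by have := ltn_ord s; have := N_ge; rewrite -addnn; lia.
by have := Zp_nat_inj sN (ltnW circ_order_gt1) H.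
Qed.

(** The listed neighbours are pairwise distinct because two steps add up to at most 2k < N, so
    [x + s] never meets [x - s']. *)
Lemma sum_circ_graph (K : nmodType) (F : 'Z_N -> K) (x : 'Z_N) :
  \sum_(y | circ_graph N k x y) F y =
  \sum_(s < k) (F (x + s.+1%:R) + F (x - s.+1%:R)).
Proof.
pose h (p : bool * 'I_k) : 'Z_N := if p.1 then x + p.2.+1%:R else x - p.2.+1%:R.
have bnd (s : 'I_k) : (s.+1 <= k)%N := ltn_ord s.
have h_inj : injective h.
  have cross (s s' : 'I_k) : x + s.+1%:R <> x - s'.+1%:R.
    move=> /addrI /eqP; rewrite -subr_eq0 opprK -natrD => /eqP H.
    have lt : (s.+1 + s'.+1 < N)%N.
      by have := bnd s; have := bnd s'; have := N_ge; rewrite -addnn; lia.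
    by have := Zp_nat_inj lt (ltnW circ_order_gt1) H.
  have ltN (s : 'I_k) : (s.+1 < N)%N by have := bnd s; have := N_ge; rewrite -addnn; lia.
  move=> [[] s] [[] s']; rewrite /h /=.
  - by move=> /addrI /(Zp_nat_inj (ltN _) (ltN _)) [] /ord_inj->.
  - by move/cross.
  - by move/esym/cross.
  - by move=> /addrI /oppr_inj /(Zp_nat_inj (ltN _) (ltN _)) [] /ord_inj->.
rewrite (eq_bigl (fun y => y \in (h @: [set: bool * 'I_k])%SET)); last first.
  move=> y; apply/existsP/imsetP => [[s]|[[b s] _ ->]].
    case/orP => /eqP H; [exists (false, s)|exists (true, s)]; rewrite // /h /= -?H.
      by rewrite opprB addrC subrK.
    by rewrite -[s.+1%:R]opprK -H opprB addrC subrK.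
  exists s; rewrite /h; case: b => /=; rewrite opprD ?opprK addrA subrr add0r ?eqxx //.
  by rewrite orbT.
rewrite big_imset /=; last by move=> ? ? _ _; exact: h_inj.
rewrite (eq_bigl xpredT) => [|p]; last by rewrite inE.
rewrite -(pair_bigA _ (fun b s => F (h (b, s)))) /= big_bool /= -big_split /=.
by apply: eq_bigr => s _; rewrite /h.
Qed.

Lemma circ_graph_regular : regular_graph (circ_graph N k) k.*2.
Proof.
move=> x; rewrite /degree -sum1_card.
have := @sum_circ_graph nat (fun=> 1%N) x; rewrite [RHS]sumr_const card_ord.
by rewrite -mulr_natr natn [RHS]mulnC muln2 => <-; apply: eq_bigl.
Qed.

Lemma circ_graph_connected : connected_graph (circ_graph N k).
Proof.
have sc : connect_sym (circ_graph N k) by apply: sym_connect_sym circ_graph_sym.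
suff H x : connect (circ_graph N k) 0 x.
  by move=> x y; rewrite (connect_trans _ (H y)) // sc.
rewrite -(natr_Zp x); elim: (nat_of_ord x) => [|n IHn]; first exact: connect0.
apply: connect_trans IHn (connect1 _); apply/existsP; exists (Ordinal k_gt0).
by rewrite -natr1 opprD addrA subrr add0r eqxx orbT.
Qed.

End Circulant.

(** * Chebyshev polynomials and D evaluated at a sum of two inverse elements *)

Section ChebyshevD.
Variable C : fieldType.
Hypothesis two_neq0 : 2%:R != 0 :> C.

Let T (s : nat) : {poly C} := chebyshevT C s \Po (2^-1 *: 'X).

Let T_rec s : T s.+2 = 'X * T s.+1 - T s.
Proof.
rewrite /T /= rmorphB /= rmorphMn /= rmorphM /= comp_polyX.
by rewrite -scalerAl -scaler_nat scalerA divff // scale1r.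
Qed.

Lemma size_chebyshevT_half s : (size (T s) <= s.+1)%N.
Proof.
suff: (size (T s) <= s.+1)%N && (size (T s.+1) <= s.+2)%N by case/andP.
elim: s => [|s /andP[IH1 IH2]].
  rewrite /T /= comp_polyC size_polyC oner_neq0 comp_polyX /=.
  by apply: leq_trans (size_scale_leq _ _) _; rewrite size_polyX.
rewrite IH2 T_rec; apply: leq_trans (size_polyD _ _) _.
rewrite size_polyN geq_max; apply/andP; split; last by apply: leq_trans IH1 _; lia.
by rewrite mulrC; apply: leq_trans (size_polyMleq _ _) _; rewrite size_polyX; lia.
Qed.

Lemma size_Dpoly k (nu : C) : (size (Dpoly k nu) <= k.+1)%N.
Proof.
apply: leq_trans (size_polyD _ _) _; rewrite size_polyN geq_max.
rewrite (leq_trans (size_polyC_leq1 _)) //=.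
apply: leq_trans (size_sum _ _ _) _; apply/bigmax_leqP_seq => s.
rewrite mem_index_iota => /andP[_ sk] _.
exact: leq_trans (size_chebyshevT_half s) _.
Qed.

Variables (A : nzRingType) (f : {rmorphism {poly C} -> A}) (X Y : A).
Hypotheses (XY : X * Y = 1) (YX : Y * X = 1) (fX : f 'X = X + Y).

(** Both sides satisfy the same three-term recurrence. The morphism is abstract because it serves
    twice: evaluation at rho + 1/rho, and substitution of the matrix S + S^-1. *)
Lemma rmorph_chebyshevT_half s : f (T s) *+ 2 = X ^+ s + Y ^+ s.
Proof.
suff: f (T s) *+ 2 = X ^+ s + Y ^+ s /\ f (T s.+1) *+ 2 = X ^+ s.+1 + Y ^+ s.+1.
  by case.
elim: s => [|s [IH1 IH2]].
  rewrite /T /= comp_polyC rmorph1 !expr0; split=> //.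
  rewrite comp_polyX !expr1 -fX -rmorphMn /= -scaler_nat scalerA divff //.
  by rewrite scale1r.
split=> //; rewrite T_rec rmorphB rmorphM /= fX mulrnBl IH1 -mulrnAr IH2.
have E1 : X * Y ^+ s.+1 = Y ^+ s by rewrite exprS mulrA XY mul1r.
have E2 : Y * X ^+ s.+1 = X ^+ s by rewrite exprS mulrA YX mul1r.
rewrite mulrDl !mulrDr E1 E2 -!exprS [X ^+ s + Y ^+ s.+2]addrC addrACA.
by rewrite [Y ^+ s + X ^+ s]addrC addrK.
Qed.

Lemma rmorph_Dpoly k (nu : C) :
  f (Dpoly k nu) *+ 2 = f (k.*2%:R + nu)%:P - \sum_(s < k) (X ^+ s.+1 + Y ^+ s.+1).
Proof.
rewrite /Dpoly rmorphB mulrnBl; congr (_ - _).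
  rewrite -rmorphMn -mulr_natl -polyC_natr -polyCM mulrDr -natrM mul2n.
  by rewrite mulrCA divff // mulr1.
rewrite rmorph_sum -sumrMnl big_add1 big_mkord.
by apply: eq_bigr => s _; exact: rmorph_chebyshevT_half.
Qed.

End ChebyshevD.

(** * Partial fractions and the Green function of the cycle *)

Section PartialFractions.
Variable C : fieldType.

(** The derivative at a root equals the value of the cofactor there; were it 0, the linear factor
    would divide [p] twice. *)
Lemma simple_root_deriv_neq0 (p : {poly C}) z :
  p != 0 -> root p z -> mup z p = 1%N -> p^`().[z] != 0.
Proof.
move=> p0 /factor_theorem[q Ep] mp; apply/eqP => dp0.
have q0 : root q z.
  by move/eqP: dp0; rewrite Ep derivM derivXsubC hornerD !hornerM
    hornerXsubC subrr mulr0 add0r hornerC mulr1.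
have [q' Eq] := factor_theorem _ _ q0.
have: (2 <= mup z p)%N by rewrite mup_geq // Ep Eq -mulrA -expr2 dvdp_mull.
by rewrite mp.
Qed.

(** This is the partial fraction expansion of 1/D multiplied by D, or Lagrange interpolation of the
    constant 1: the difference has degree below k and vanishes at the k distinct [phi c]. *)
Lemma partial_fractions k (D : {poly C}) (phi : 'I_k -> C) :
    (0 < k)%N -> injective phi -> (size D <= k.+1)%N ->
    (forall c, root D (phi c)) -> (forall c, D^`().[phi c] != 0) ->
  \sum_c (D^`().[phi c])^-1 *: (D %/ ('X - (phi c)%:P)) = 1.
Proof.
move=> k_gt0 phi_inj sD rD dD; pose Q c := D %/ ('X - (phi c)%:P).
have DQ c : D = Q c * ('X - (phi c)%:P) by rewrite divpK // dvdp_XsubCl.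
have Q1 c : (Q c).[phi c] = D^`().[phi c].
  by rewrite [in RHS](DQ c) derivM derivXsubC hornerD !hornerM
    hornerXsubC subrr mulr0 add0r hornerC mulr1.
have Q0 c j : j != c -> (Q c).[phi j] = 0.
  move=> jc; have /eqP := rD j; rewrite (DQ c) hornerM hornerXsubC => /eqP.
  by rewrite mulf_eq0 subr_eq0 (inj_eq phi_inj) (negbTE jc) orbF => /eqP.
apply/eqP; rewrite -subr_eq0; apply/eqP.
apply: (@roots_geq_poly_eq0 _ _ [seq phi c | c <- enum 'I_k]).
- apply/allP => _ /mapP[j _ ->]; rewrite /root hornerD hornerN hornerC horner_sum (bigD1 j) //=.
  rewrite big1 => [|c cj]; last by rewrite hornerZ Q0 ?mulr0 // eq_sym.
  by rewrite hornerZ Q1 mulVf // addr0 subrr.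
- by rewrite map_inj_uniq // enum_uniq.
- rewrite size_map size_enum_ord; apply: leq_trans (size_polyD _ _) _.
  rewrite size_polyN size_poly1 geq_max k_gt0 andbT.
  apply: leq_trans (size_sum _ _ _) _; apply/bigmax_leqP => c _.
  apply: leq_trans (size_scale_leq _ _) _.
  by rewrite size_divp ?polyXsubC_eq0 // size_XsubC leq_subLR add1n.
Qed.

End PartialFractions.

Section UnitRoots.
Variable C : numClosedFieldType.

(** A root of unity has modulus 1, so the sum of powers in 2D is at most 2k in modulus, which is
    less than 2k + nu. *)
Lemma Dpoly_unit_root_neq0 k (nu rho : C) M : 0 < nu -> rho ^+ M.+1 = 1 ->
  (Dpoly k nu).[rho + rho^-1] != 0.
Proof.
move=> nu_gt0 rM.
have r0 : rho != 0 by apply: contra_eq_neq rM => ->; rewrite expr0n eq_sym oner_neq0.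
have nr1 : `|rho| = 1.
  by apply/eqP; rewrite -(@pexpr_eq1 _ _ M.+1) // -normrX rM normr1.
apply/eqP => D0.
have two0 : 2%:R != 0 :> C by rewrite pnatr_eq0.
have /eqP := rmorph_Dpoly (f := horner_eval (rho + rho^-1)) two0
  (mulfV r0) (mulVf r0) (hornerX _) k nu.
rewrite /= /horner_eval D0 mul0rn hornerC eq_sym subr_eq0 => /eqP E.
have: `|k.*2%:R + nu| <= k.*2%:R.
  rewrite E; apply: le_trans (ler_norm_sum _ _ _) _.
  apply: (@le_trans _ _ (\sum_(s < k) (2%:R : C))).
    apply: ler_sum => s _; apply: le_trans (ler_normD _ _) _.
    by rewrite !normrX normfV nr1 invr1 expr1n.
  by rewrite sumr_const card_ord -mulrnA mul2n.
rewrite ger0_norm; last by rewrite addr_ge0 ?ler0n // ltW.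
by rewrite gerDl (lt_geF nu_gt0).
Qed.

End UnitRoots.

Section CycleGreen.
Variables (C : fieldType) (N : nat).
Implicit Types rho : C.
Hypothesis N_gt1 : (1 < N)%N.

(** Periodic Green function of the cycle: both powers solve the homogeneous recurrence, their sum is
    symmetric under [n -> N - n], and the denominator normalises the jump at 0. *)
Definition cycle_green (rho : C) (n : nat) : C :=
  (rho ^+ n + rho ^+ (N - n)) / ((rho - rho^-1) * (1 - rho ^+ N)).

Lemma cycle_green_sym rho n : (n <= N)%N -> cycle_green rho (N - n) = cycle_green rho n.
Proof. by move=> nN; rewrite /cycle_green subKn // addrC. Qed.

Lemma cycle_greenE rho (x : 'Z_N) : rho != 0 -> rho ^+ 2 != 1 -> rho ^+ N != 1 ->
  cycle_green rho (x + 1)%R + cycle_green rho (x - 1)%R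
  - (rho + rho^-1) * cycle_green rho x = (x == 0)%:R.
Proof.
move=> r0 r2 rN.
have d1 : rho - rho^-1 != 0.
  apply: contra_neq r2 => /eqP; rewrite subr_eq0 => /eqP E.
  by rewrite expr2 {2}E mulfV.
have d2 : 1 - rho ^+ N != 0 by rewrite subr_eq0 eq_sym.
have xN : (x < N)%N by have := ltn_ord x; rewrite [X in (_ < X)%N](Zp_cast N_gt1).
(* The formula takes equal values at 0 and at [N], so the wrap-around of [x + 1] is harmless. *)
have gS n : (n <= N)%N -> cycle_green rho (n%:R : 'Z_N) = cycle_green rho n.
  rewrite leq_eqVlt val_Zp_nat // => /orP[/eqP->|nN]; last by rewrite modn_small.
  by rewrite modnn -{1}(subnn N) cycle_green_sym.
have -> : cycle_green rho (x + 1)%R = cycle_green rho x.+1.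
  by rewrite -{1}(natr_Zp x) natr1 gS.
have [x0|x0] := eqVneq x 0.
  rewrite x0 sub0r.
  have -> : cycle_green rho (0%R : 'Z_N) = cycle_green rho 0 by [].
  have -> : - 1 = (N - 1)%:R :> 'Z_N by rewrite natrB ?(ltnW N_gt1) // pchar_Zp // sub0r.
  rewrite gS ?leq_subr // cycle_green_sym ?(ltnW N_gt1) // /cycle_green.
  have EN : rho ^+ N = rho * rho ^+ (N - 1) by rewrite -exprS -subSn ?subn1 // ltnW.
  rewrite subn0 EN expr1 expr0; rewrite EN in d2.
  rewrite mulr1n; move: (rho ^+ (N - 1)) d2 => t d2.
  by field; rewrite r0 d2 -expr2 subr_eq0 r2.
have x_gt0 : (0 < x)%N by rewrite lt0n.
have -> : x - 1 = (x.-1)%:R :> 'Z_N by rewrite -{1}(natr_Zp x) -subn1 natrB.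
rewrite gS ?(leq_trans (leq_pred _) (ltnW xN)) // /cycle_green mulr0n.
case: (nat_of_ord x) x_gt0 xN => [//|n] _ nN /=.
have -> : (N - n.+1 = (N - n.+2).+1)%N by lia.
have -> : (N - n = (N - n.+2).+2)%N by lia.
rewrite !exprS; move: (rho ^+ n) (rho ^+ (N - _)) (rho ^+ N) d2 => s t u d2.
by field; rewrite r0 d2 -expr2 subr_eq0 r2.
Qed.


(** The quotient formula for [Vseq] is kept multiplied out, so that it also holds when
    [eta - eta^-1] vanishes. *)
Lemma Vseq_closed_form (eta : C) n : eta != 0 ->
  Vseq (eta + eta^-1) n * (eta - eta^-1) = eta ^+ n - eta^-1 ^+ n.
Proof.
move=> eta0; set g := eta + eta^-1; set d := eta - eta^-1.
suff: Vseq g n * d = eta ^+ n - eta^-1 ^+ n /\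
      Vseq g n.+1 * d = eta ^+ n.+1 - eta^-1 ^+ n.+1 by case.
elim: n => [|n [IH1 IH2]]; first by rewrite !expr0 subrr mul0r mul1r !expr1.
split=> //; have -> : Vseq g n.+2 = g * Vseq g n.+1 - Vseq g n by [].
by rewrite mulrBl -mulrA IH1 IH2 /g !exprS; field.
Qed.

(** With rho = eta^2, the numerator factors as (1 - rho^l)(1 - rho^(N-l)), and 1 - rho^n is -eta^n
    (eta - 1/eta) V_n. The powers of eta cancel, and rho - 1/rho = (eta - 1/eta)(eta + 1/eta) leaves
    the factor 1/gamma. *)
Lemma cycle_green_diff (eta : C) l : eta != 0 ->
    (eta ^+ 2) ^+ 2 != 1 -> (eta ^+ 2) ^+ N != 1 -> (l <= N)%N ->
  cycle_green (eta ^+ 2) 0 - cycle_green (eta ^+ 2) l =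
  - ((eta + eta^-1)^-1 *
     (Vseq (eta + eta^-1) l * Vseq (eta + eta^-1) (N - l) / Vseq (eta + eta^-1) N)).
Proof.
move=> eta0 r2 rN lN.
have h2 : (eta * eta - 1) * (eta * eta + 1) != 0.
  by rewrite -expr2 -subr_sqr_1 subr_eq0.
have [h2m h2p] : eta * eta - 1 != 0 /\ eta * eta + 1 != 0.
  by move: h2; rewrite mulf_eq0 negb_or => /andP[].
have d0 : eta - eta^-1 != 0.
  apply: contra_neq h2m => H; have := congr1 (fun z => z * eta) H.
  by rewrite mulrBl mulVf // mul0r.
have V n : Vseq (eta + eta^-1) n = (eta ^+ n - eta^-1 ^+ n) / (eta - eta^-1).
  by rewrite -Vseq_closed_form // mulfK.
have EN : eta ^+ N = eta ^+ l * eta ^+ (N - l) by rewrite -exprD subnKC.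
rewrite !V /cycle_green subn0 expr0 !exprVn -!exprM ![(2 * _)%N]mulnC !exprM.
move: rN; rewrite -exprM mulnC exprM EN.
have := expf_neq0 l eta0; have := expf_neq0 (N - l) eta0.
move: (eta ^+ l) (eta ^+ (N - l)) => a b b0 a0 rN.
have rN' : a * b * (a * b) - 1 != 0 by rewrite subr_eq0 -expr2.
by field; rewrite eta0 h2m b0 a0 rN' h2p -expr2 ![_ - _ == 0]subr_eq0 eq_sym rN r2.
Qed.

End CycleGreen.

(** * The circulant Laplacian as a polynomial in the shift, and its resolvent *)

Section CirculantResolvent.
Variables (C : fieldType) (N : nat).
Local Notation n := (Zp_trunc N).+2.

Definition shift_mx (d : 'Z_N) : 'M[C]_n := \matrix_(i, j) ((j : 'Z_N) == i + d)%:R.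

Lemma mul_shift_mx p d (A : 'M[C]_(n, p)) (i : 'Z_N) j : (shift_mx d *m A) i j = A (i + d) j.
Proof.
rewrite mxE (bigD1 (i + d)) //= mxE eqxx mul1r big1 ?addr0 // => k /negbTE ki.
by rewrite mxE ki mul0r.
Qed.

Lemma shift_mxD d d' : shift_mx d * shift_mx d' = shift_mx (d + d').
Proof. by apply/matrixP => i j; rewrite mul_shift_mx !mxE addrA. Qed.

Lemma shift_mx0 : shift_mx 0 = 1.
Proof. by apply/matrixP => i j; rewrite !mxE addr0 eq_sym. Qed.

Lemma shift_mxX d s : shift_mx d ^+ s = shift_mx (d *+ s).
Proof.
by elim: s => [|s IHs]; rewrite ?expr0 ?mulr0n ?shift_mx0 // exprS IHs shift_mxD mulrS.
Qed.

Hypothesis two_neq0 : 2%:R != 0 :> C.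
Variables (k : nat) (nu : C) (phi rho : 'I_k -> C).
Hypotheses (k_gt0 : (0 < k)%N) (N_ge : (k.*2.+1 <= N)%N).
Let D : {poly C} := Dpoly k nu.
Hypotheses (phi_inj : injective phi) (phi_root : forall c, root D (phi c)).
Hypothesis (phi_deriv : forall c, D^`().[phi c] != 0).
Hypotheses (rho_neq0 : forall c, rho c != 0).
Hypothesis (rho_phi : forall c, rho c + (rho c)^-1 = phi c).
Hypotheses (rho2 : forall c, rho c ^+ 2 != 1) (rhoN : forall c, rho c ^+ N != 1).

(** This is D(S + S^-1)^-1 applied to the point mass at 0, that is, twice the resolvent of the
    Laplacian. *)
Definition circ_resolvent (x : 'Z_N) : C :=
  \sum_c (D^`().[phi c])^-1 * cycle_green N (rho c) x.

(* The Laplacian of the circulant graph plus [nu] is [2 D(S + S^-1)], with [S]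
   the shift, so that [1/D] is expanded in partial fractions. *)
Lemma circ_resolventE (x : 'Z_N) :
  \sum_(y | circ_graph N k x y) (circ_resolvent x - circ_resolvent y)
  + nu * circ_resolvent x = 2 * (x == 0)%:R.
Proof.
have N_gt1 := circ_order_gt1 k_gt0 N_ge.
pose M := shift_mx 1 + shift_mx (-1).
pose G c : 'cV[C]_n := \col_i cycle_green N (rho c) (i : 'Z_N).
pose W : 'cV[C]_n := \sum_c (D^`().[phi c])^-1 *: G c.
pose e0 : 'cV[C]_n := \col_i ((i : 'Z_N) == 0)%:R.
have WE y : W y 0 = circ_resolvent y.
  by rewrite /W summxE; apply: eq_bigr => c _; rewrite !mxE.
have GE c : (M - (phi c)%:M) *m G c = e0.
  apply/matrixP => i j; rewrite mulmxBl mulmxDl mul_scalar_mx.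
  rewrite mxE [X in X + _]mxE !mul_shift_mx !mxE -rho_phi.
  exact: cycle_greenE.
(* Writing D as its cofactor times ['X - phi c] and cancelling the linear factor against [G c]
   leaves cofactors applied to [e0]; their weighted sum is 1 by [partial_fractions]. *)
have DW : horner_mx M D *m W = e0.
  rewrite /W mulmx_sumr.
  transitivity (\sum_c (D^`().[phi c])^-1 *: (horner_mx M (D %/ ('X - (phi c)%:P)) *m e0)).
    apply: eq_bigr => c _; rewrite -scalemxAr; congr (_ *: _).
    have {1}-> : D = (D %/ ('X - (phi c)%:P)) * ('X - (phi c)%:P).
      by rewrite divpK // dvdp_XsubCl.
    by rewrite rmorphM rmorphB /= horner_mx_X horner_mx_C -mulmxE -mulmxA GE.
  rewrite -[RHS]mul1mx -[1%:M](rmorph1 (horner_mx M)).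
  rewrite -(partial_fractions k_gt0 phi_inj (size_Dpoly two_neq0 k nu) phi_root phi_deriv).
  rewrite rmorph_sum mulmx_suml; apply: eq_bigr => c _.
  by rewrite /= horner_mxZ -scalemxAl.
clearbody W.
have XY : shift_mx 1 * shift_mx (-1) = 1 by rewrite shift_mxD subrr shift_mx0.
have YX : shift_mx (-1) * shift_mx 1 = 1 by rewrite shift_mxD addNr shift_mx0.
have := rmorph_Dpoly (f := horner_mx M) two_neq0 XY YX (horner_mx_X _) k nu.
rewrite [X in _ = X - _](horner_mx_C M) => /(congr1 (fun A => (A *m W) x 0)).
rewrite mulr2n mulmxDl DW mulmxBl mul_scalar_mx.
have -> : 2 * (x == 0)%:R = e0 x 0 + e0 x 0 by rewrite !mxE mulr_natl mulr2n.
rewrite mxE => ->; rewrite [RHS]mxE [X in _ = X + _]mxE [X in _ = _ + X]mxE mulmx_suml summxE.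
rewrite sumrB sumr_const; have := circ_graph_regular k_gt0 N_ge x.
rewrite /degree => ->; rewrite sum_circ_graph // addrAC -[X in X + _ - _]mulr_natl -mulrDl WE.
congr (_ - _); apply: eq_bigr => s _.
by rewrite mulmxDl mxE !shift_mxX !mul_shift_mx !WE mulNrn.
Qed.

Lemma circ_resolvent_sym x : circ_resolvent (- x) = circ_resolvent x.
Proof.
have N_gt1 := circ_order_gt1 k_gt0 N_ge.
apply: eq_bigr => c _; congr (_ * _).
(* Negation is [n -> N - n] on representatives, except at 0, whose representative is not [N]. *)
have [->|x0] := eqVneq x 0; first by rewrite oppr0.
have xN : (x < N)%N by have := ltn_ord x; rewrite [X in (_ < X)%N](Zp_cast N_gt1).
have -> : - x = (N - x)%:R.
  by rewrite natrB ?(ltnW xN) // pchar_Zp // sub0r natr_Zp.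
rewrite val_Zp_nat // modn_small ?cycle_green_sym ?(ltnW xN) //.
by rewrite -subn_gt0 subKn ?(ltnW xN) // lt0n.
Qed.

End CirculantResolvent.

(** * Spectral decomposition of the Laplacian *)

Section MaximumPrinciple.
Variables (R : realDomainType) (V : finType) (e : rel V).

(** Maximum principle: at a maximum all the differences are nonnegative and sum to 0, so the
    neighbours attain the maximum too, and it spreads along paths. *)
Lemma harmonic_const (f : V -> R) : connected_graph e ->
  (forall u, \sum_(v | e u v) (f u - f v) = 0) -> forall u v, f u = f v.
Proof.
move=> cV Lf a b; case: (@arg_maxP _ _ _ a xpredT f isT) => u0 _ max_u0.
suff H v : f v = f u0 by rewrite !H.
have /connectP[p] := cV u0 v; elim/last_ind: p v => [|p w IHp] v /=; first by move=> _ ->.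
rewrite last_rcons rcons_path => /andP[Hp ew] ->{v}.
have fz : f (last u0 p) = f u0 by apply: IHp Hp erefl.
have ge0 v : e (last u0 p) v -> 0 <= f (last u0 p) - f v.
  by move=> _; rewrite subr_ge0 fz; exact: max_u0.
by have /eqP := psumr_eq0P ge0 (Lf (last u0 p)) ew; rewrite subr_eq0 fz => /eqP.
Qed.

End MaximumPrinciple.

Section SymmetricSpectrum.
Variable R : rcfType.

(** The spectral theorem over [R[i]] shows that a product of distinct real linear factors
    annihilates [A]; this relation descends to [R] and makes [A] diagonalizable there. *)
Lemma symmetric_eigenspaces_full n (A : 'M[R]_n) t (nu : 'I_t -> R) :
    A^T = A -> injective nu ->
    (forall x, eigenvalue A x -> exists i, x = nu i) ->
  (1%:M <= \sum_i eigenspace A (nu i))%MS.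
Proof.
case: n A => [|n] A symA nu_inj nu_spec; first by rewrite [1%:M]thinmx0 sub0mx.
pose B := map_mx (real_complex R) A.
have hB : B \is hermsymmx.
  apply: realsym_hermsym.
    apply/is_hermitianmxP.
    by rewrite expr0 scale1r map_mx_id // /B map_trmx symA.
  by apply/mxOverP => i j; rewrite mxE; apply/complex_realP; exists (A i j).
have uP := spectral_unit B.
have eB := elimT (@orthomx_spectralP _ _ B) (hermitian_normalmx hB).
have spec_nu j : exists i, spectral_diag B 0 j = (nu i)%:C%C.
  have /mxOverP/(_ 0 j)/complex_realP[x Ex] := hermitian_spectral_diag_real hB.
  have: eigenvalue B x%:C%C.
    apply/eigenvalueP; exists (row j (spectralmx B)); last first.
      apply/eqP => rP; have := congr1 (row j) (mulmxV uP).
      rewrite row_mul rP mul0mx => /rowP/(_ j).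
      by rewrite !mxE eqxx => /eqP; rewrite eq_sym oner_eq0.
    rewrite -row_mul {2}eB !mulmxA mulmxV // mul1mx -Ex.
    by apply/rowP => i; rewrite mul_diag_mx !mxE.
  rewrite eigenvalue_root_char /B -map_char_poly fmorph_root -eigenvalue_root_char.
  by move=> /nu_spec[i Exi]; exists i; rewrite Ex Exi.
pose q := \prod_(r <- [seq nu i | i <- enum 'I_t]) ('X - r%:P).
have qA : horner_mx A q = 0.
  apply: (map_mx_inj (f := real_complex R)); rewrite map_horner_mx map_mx0 -/B.
  rewrite eB horner_mx_uconjC // horner_mx_diag.
  rewrite (_ : map_mx _ _ = 0) ?linear0 ?mulmx0 ?mul0mx //.
  apply/rowP => j; rewrite !mxE; have [i ->] := spec_nu j.
  rewrite horner_map /=; apply/eqP; rewrite fmorph_eq0.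
  rewrite -[_ == 0]/(root q (nu i)) root_prod_XsubC.
  by rewrite map_f // mem_enum.
have /diagonalizablePeigen[rs urs rsE] : diagonalizable A.
  apply/diagonalizableP; exists [seq nu i | i <- enum 'I_t].
    by rewrite map_inj_uniq // enum_uniq.
  exact: mxminpoly_min.
rewrite -rsE; apply: (big_ind (fun X => (X <= _)%MS)) => [|X Y sX sY|r _].
- exact: sub0mx.
- by rewrite addsmx_sub sX.
have [->|Er] := eqVneq (eigenspace A r) 0; first exact: sub0mx.
by have [i ->] := nu_spec r Er; rewrite (sumsmx_sup i).
Qed.

(** A row [w] in the intersection has w w^T = 0, a sum of real squares. This directness is what lets
    [proj_mx] act as the orthogonal projection. *)
Lemma cap_kermx_tr n m (U : 'M[R]_(m, n)) : (U :&: kermx U^T = 0)%MS.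
Proof.
apply/eqP; rewrite -submx0; apply/row_subP => i.
set w := row i _; have := row_sub i (U :&: kermx U^T)%MS; rewrite -/w sub_capmx.
move=> /andP[/submxP[x Ex] /sub_kermxP wU].
have ww : w *m w^T = 0 by rewrite {1}Ex -mulmxA -[U]trmxK -trmx_mul wU trmx0 mulmx0.
suff -> : w = 0 by exact: sub0mx.
clearbody w; apply/rowP => j; rewrite [RHS]mxE; apply/eqP.
have /matrixP/(_ 0 0) := ww; rewrite [RHS]mxE mxE => /eqP.
rewrite psumr_eq0 => [/allP/(_ j (mem_index_enum _))|k _]; rewrite mxE.
  by rewrite mulf_eq0 orbb.
by rewrite -expr2 sqr_ge0.
Qed.

Section Projections.
Variables (n t : nat) (A : 'M[R]_n) (nu : 'I_t -> R).
Hypotheses (symA : A^T = A) (nu_inj : injective nu).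
Hypothesis nu_spec : forall x, eigenvalue A x -> exists i, x = nu i.

Lemma eigenproj_eigen i : eigenproj A (nu i) *m A = nu i *: eigenproj A (nu i).
Proof.
apply/eigenspaceP; rewrite -[X in (X <= _)%MS]mul1mx; exact: proj_mx_sub.
Qed.

Lemma eigenproj_id m i (W : 'M[R]_(m, n)) : W *m A = nu i *: W ->
  W *m eigenproj A (nu i) = W.
Proof. by move=> /eigenspaceP WE; apply: proj_mx_id => //; exact: cap_kermx_tr. Qed.

Lemma eigenproj_orth m i (W : 'M[R]_(m, n)) : W *m (eigenspace A (nu i))^T = 0 ->
  W *m eigenproj A (nu i) = 0.
Proof. by move=> /sub_kermxP WE; apply: proj_mx_0 => //; exact: cap_kermx_tr. Qed.

Lemma eigenspace_orth i j : i != j ->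
  eigenspace A (nu i) *m (eigenspace A (nu j))^T = 0.
Proof.
move=> ij; set U := eigenspace A (nu i); set W := eigenspace A (nu j).
have UA : U *m A = nu i *: U by apply/eigenspaceP.
have WA : W *m A = nu j *: W by apply/eigenspaceP.
have: nu i *: (U *m W^T) = nu j *: (U *m W^T).
  by rewrite scalemxAl -UA -mulmxA -{1}symA -trmx_mul WA linearZ /= scalemxAr.
move/eqP; rewrite -subr_eq0 -scalerBl scalemx_eq0 subr_eq0 (inj_eq nu_inj) (negbTE ij).
by move/eqP.
Qed.

(** Split the identity into eigenspace components: each projection fixes its own component and kills
    the others by orthogonality. *)
Lemma sum_eigenproj : \sum_i eigenproj A (nu i) = 1%:M.
Proof.
have /sub_sumsmxP[X EX] := symmetric_eigenspaces_full symA nu_inj nu_spec.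
rewrite -[LHS]mul1mx EX mulmx_suml; apply: eq_bigr => j _.
rewrite mulmx_sumr (bigD1 j) //= big1 => [|i ij].
  by rewrite addr0 -mulmxA eigenproj_id //; apply/eigenspaceP.
by rewrite -mulmxA eigenproj_orth ?mulmx0 // eigenspace_orth // eq_sym.
Qed.

End Projections.

End SymmetricSpectrum.

Section LaplacianMatrix.
Variables (R : comNzRingType) (V : finType) (e : rel V) (r : nat).
Hypotheses (e_sym : symmetric e) (e_reg : regular_graph e r).
Let L : 'M[R]_#|V| := laplacian R e r.

Lemma laplacian_sym : L^T = L.
Proof.
by rewrite /L /laplacian linearB /= tr_scalar_mx; congr (_ - _);
  apply/matrixP => i j; rewrite !mxE e_sym.
Qed.

Lemma mul_laplacian m (w : 'M[R]_(m, #|V|)) i b :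
  (w *m L) i (enum_rank b) =
  \sum_(c | e b c) (w i (enum_rank b) - w i (enum_rank c)).
Proof.
rewrite mulmxBr mul_mx_scalar sumrB sumr_const -(e_reg b) /degree mxE [X in X + _]mxE.
rewrite [X in _ + X]mxE mulr_natl; congr (_ - _).
rewrite mxE (reindex enum_rank) /=; last by apply: onW_bij; exact: enum_rank_bij.
rewrite [RHS]big_mkcond; apply: eq_bigr => c _.
by rewrite mxE !enum_rankK e_sym; case: (e b c); rewrite ?mulr1 ?mulr0.
Qed.

End LaplacianMatrix.

Section LaplacianSpectrum.
Variables (R : rcfType) (V : finType) (e : rel V) (r : nat).
Hypotheses (e_sym : symmetric e) (e_reg : regular_graph e r).
Let L : 'M[R]_#|V| := laplacian R e r.
Variables (t : nat) (nu : 'I_t -> R).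
Hypothesis nu_inj : injective nu.
Hypothesis nu_spec : forall x, eigenvalue L x -> exists i, x = nu i.

Definition spectral_entry i (a b : V) : R :=
  eigenproj L (nu i) (enum_rank a) (enum_rank b).

Lemma sum_spectral_entry a b : \sum_i spectral_entry i a b = (a == b)%:R.
Proof.
have := sum_eigenproj (laplacian_sym R r e_sym) nu_inj nu_spec.
move/matrixP/(_ (enum_rank a) (enum_rank b)); rewrite summxE => ->.
by rewrite mxE (inj_eq enum_rank_inj).
Qed.

Lemma laplacian_spectral_entry i a b :
  \sum_(c | e b c) (spectral_entry i a b - spectral_entry i a c) =
  nu i * spectral_entry i a b.
Proof. by rewrite -(mul_laplacian e_sym e_reg) eigenproj_eigen mxE. Qed.

(** The kernel of the Laplacian consists of constants, by the maximum principle. Hence the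
    projection fixes [one] and kills [w], the point mass at [a] minus its mean, which is orthogonal
    to constants. *)
Lemma spectral_entry0 i a b : connected_graph e -> nu i = 0 ->
  spectral_entry i a b = (#|V|%:R)^-1.
Proof.
move=> e_conn nui0.
have V0 : #|V|%:R != 0 :> R by rewrite pnatr_eq0 -lt0n; apply/card_gt0P; exists a.
pose one : 'rV[R]_#|V| := const_mx 1.
have one_id : one *m eigenproj L (nu i) = one.
  apply: eigenproj_id; rewrite nui0 scale0r; apply/rowP => j.
  rewrite -(enum_valK j) (mul_laplacian e_sym e_reg) [RHS]mxE big1 // => c _.
  by rewrite !mxE subrr.
pose w : 'rV[R]_#|V| := delta_mx 0 (enum_rank a) - (#|V|%:R)^-1 *: one.
have w0 : w *m eigenproj L (nu i) = 0.
  apply: eigenproj_orth; apply/rowP => j; rewrite [RHS]mxE.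
  set U := eigenspace L _.
  have UL : U *m L = nu i *: U by apply/eigenspaceP.
  clearbody U.
  have Uconst c : U j (enum_rank c) = U j (enum_rank a).
    apply: (harmonic_const (f := fun c => U j (enum_rank c)) e_conn) => u.
    by rewrite -(mul_laplacian e_sym e_reg) UL nui0 scale0r mxE.
  rewrite mulmxBl -scalemxAl -rowE !mxE.
  rewrite (eq_bigr (fun=> U j (enum_rank a))) => [|c _]; last first.
    by rewrite !mxE mul1r -(enum_valK c).
  by rewrite sumr_const card_ord -[U j _ *+ _]mulr_natl mulKf // subrr.
rewrite /spectral_entry.
have := congr1 (fun A : 'rV_ _ => A 0 (enum_rank b)) w0.
rewrite mulmxBl -scalemxAl one_id -rowE !mxE mulr1 => /eqP.
by rewrite subr_eq0 => /eqP.
Qed.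

End LaplacianSpectrum.

(** * Expected hitting times *)

Section HittingTime.
Import numFieldNormedType.Exports.
Local Open Scope classical_set_scope.
Variables (R : realType) (d : measure_display) (Omega : measurableType d).
Variable P : probability Omega R.

Definition prob (A : set Omega) : R := fine (P A).

Lemma probE A : measurable A -> P A = (prob A)%:E.
Proof. by move=> mA; rewrite /prob fineK // fin_num_measure. Qed.

Lemma prob_ge0 A : 0 <= prob A.
Proof. exact: fine_ge0. Qed.

Lemma prob_le A B : measurable A -> measurable B -> A `<=` B -> prob A <= prob B.
Proof.
by move=> mA mB AB; rewrite -lee_fin -!probE // le_measure // inE.
Qed.

Lemma prob_partition (I : finType) (X : Omega -> I) (A : set Omega) :
    measurable A -> (forall i, measurable (X @^-1` [set i])) ->
  prob A = \sum_i prob (A `&` X @^-1` [set i]).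
Proof.
move=> mA mX; apply: EFin_inj; rewrite -probE // -sumEFin.
have mAX i : measurable (A `&` X @^-1` [set i]) by exact: measurableI.
under eq_bigr do rewrite -probE //.
rewrite bigfs ?index_enum_uniq //; last by move=> i _; rewrite mem_index_enum.
rewrite -measure_fin_bigcup //.
- congr (P _); apply/seteqP; split=> [w Aw|w [i _ []] //].
  by exists (X w).
- by move=> i j _ _ [w [[_ <-] [_ <-]]].
Qed.

Lemma measurable_initial (B : nat -> set Omega) n :
  (forall i, measurable (B i)) -> measurable [set w | forall i, (i <= n)%N -> B i w].
Proof.
move=> mB; rewrite (_ : [set w | _] = \bigcap_(i in [set i | (i <= n)%N]) B i) //.
by apply: bigcap_measurable => //; exists 0%N.
Qed.

Variables (V : finType) (e : rel V) (u v : V) (Z : nat -> Omega -> V).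
Hypothesis Z_srw : simple_random_walk P e u Z.

Lemma measurable_walk n (B : set V) : measurable (Z n @^-1` B).
Proof.
have [mZ _ _] := Z_srw.
rewrite -[Z n @^-1` B](_ : \bigcup_(x in B) Z n @^-1` [set x] = _).
  by apply: fin_bigcup_measurable => // x _; exact: mZ.
by apply/seteqP; split=> [w [x Bx /= ->]|w Bw] //; exists (Z n w).
Qed.

(** The event T_v > n. *)
Definition avoids n : set Omega := [set w | forall i, (i <= n)%N -> Z i w <> v].

Lemma measurable_avoids n : measurable (avoids n).
Proof.
apply: (measurable_initial (B := fun i => Z i @^-1` [set x | x <> v])) => i.
exact: measurable_walk.
Qed.

Definition avoid_prob n x : R := prob (avoids n `&` Z n @^-1` [set x]).

Lemma measurable_avoidsI n x : measurable (avoids n `&` Z n @^-1` [set x]).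
Proof. by apply: measurableI; [exact: measurable_avoids|exact: measurable_walk]. Qed.

Lemma avoid_prob_target n : avoid_prob n v = 0.
Proof.
rewrite /avoid_prob (_ : _ `&` _ = set0) ?/prob ?measure0 //.
by apply/seteqP; split=> // w [/(_ n (leqnn n))].
Qed.

Lemma prob_avoids n : prob (avoids n) = \sum_x avoid_prob n x.
Proof.
apply: prob_partition; first exact: measurable_avoids.
by move=> x; exact: measurable_walk.
Qed.

Lemma avoid_prob0 x : x != v -> avoid_prob 0 x = (x == u)%:R.
Proof.
move=> xv; have [_ Z0 _] := Z_srw; rewrite /avoid_prob.
have -> : avoids 0 `&` Z 0%N @^-1` [set x] = Z 0%N @^-1` [set x].
  apply/seteqP; split=> [w [//]|w /= Zw]; split=> // i; rewrite leqn0 => /eqP->.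
  by rewrite Zw; apply/eqP.
have [->|xu] := eqVneq x u; first by rewrite /prob Z0.
apply/eqP; rewrite eq_le prob_ge0 andbT.
have mu_ := measurable_walk 0%N [set u].
(* The start at [u] already has probability 1, and starting at [x] is a disjoint event. *)
apply: (@le_trans _ _ (1 - prob (Z 0%N @^-1` [set u]))); last by rewrite /prob Z0 subrr.
rewrite lerBrDr -lee_fin EFinD -!probE //; last exact: measurable_walk.
rewrite -measureU //; last first.
- by apply/seteqP; split=> // w /= [-> E]; rewrite E eqxx in xu.
- exact: measurable_walk.
- by apply: probability_le1; apply: measurableU => //; exact: measurable_walk.
Qed.

Let path_set n (z : nat -> V) := [set w | forall i, (i <= n)%N -> Z i w = z i].

Let prob_path n z : prob (path_set n.+1 z) = prob (path_set n z) * srw_step R e (z n) (z n.+1).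
Proof.
have [_ _ markov] := Z_srw; apply: EFin_inj; rewrite EFinM.
have mP k : measurable (path_set k z).
  apply: (measurable_initial (B := fun i => Z i @^-1` [set z i])) => i.
  exact: measurable_walk.
by rewrite -!probE //; exact: markov.
Qed.

(** The Markov property is given for complete trajectories only, so the event is split according to
    the first [n.+1] positions. *)
Lemma prob_step n x y :
  prob (avoids n `&` Z n @^-1` [set x] `&` Z n.+1 @^-1` [set y]) =
  avoid_prob n x * srw_step R e x y.
Proof.
pose X w : {ffun 'I_n.+1 -> V} := [ffun i : 'I_n.+1 => Z i w].
(* The trajectory [z] continued by [y] after time [n], so that one Markov step covers the move to
   [y]. *)
pose ext (z : {ffun 'I_n.+1 -> V}) i := if (i <= n)%N then z (inord i) else y.
have XE z : X @^-1` [set z] = path_set n (ext z).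
  apply/seteqP; split=> [w /= <- i ile|w Hw].
    by rewrite /ext ile ffunE inordK.
  apply/ffunP => i; have ile : (i <= n)%N by rewrite -ltnS.
  by rewrite ffunE Hw // /ext ile inord_val.
have mX z : measurable (X @^-1` [set z]).
  rewrite XE; apply: (measurable_initial (B := fun i => Z i @^-1` [set ext z i])) => i.
  exact: measurable_walk.
rewrite /avoid_prob (prob_partition _ mX); last first.
  by apply: measurableI; [exact: measurable_avoidsI|exact: measurable_walk].
rewrite [in RHS](prob_partition _ mX); last exact: measurable_avoidsI.
rewrite mulr_suml; apply: eq_bigr => z _; rewrite XE.
(* Trajectories that meet [v] or do not end at [x] contribute 0 to both sides. *)
have [[Hv Hx]|nH] := pselect ((forall i, (i <= n)%N -> ext z i <> v) /\ ext z n = x).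
  rewrite (_ : _ `&` path_set n _ = path_set n.+1 (ext z)); last first.
    apply/seteqP; split=> [w [[_ /= Zy] Hw] i|w Hw].
      by rewrite leq_eqVlt => /orP[/eqP->|/Hw//]; rewrite Zy /ext ltnn.
    have Hw' i : (i <= n)%N -> Z i w = ext z i by move=> /leqW/Hw.
    split=> //; split; last by rewrite /= Hw // /ext ltnn.
    by split=> [i ile|]; rewrite ?Hw' //; [exact: Hv|rewrite /= Hw'].
  rewrite (_ : _ `&` path_set n _ = path_set n (ext z)); last first.
    apply/seteqP; split=> [w []//|w Hw]; split=> //.
    by split=> [i ile|]; rewrite /= ?Hw //; exact: Hv.
  by rewrite prob_path Hx /ext ltnn.
have E0 : avoids n `&` Z n @^-1` [set x] `&` path_set n (ext z) = set0.
  apply/seteqP; split=> // w [[Aw /= Zx] Hw]; apply: nH; split.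
    by move=> i ile; rewrite -Hw //; exact: Aw.
  by rewrite -Hw.
by rewrite setIAC E0 set0I /prob measure0 mul0r.
Qed.

Lemma avoid_probS n y : y != v ->
  avoid_prob n.+1 y = \sum_x avoid_prob n x * srw_step R e x y.
Proof.
move=> yv; rewrite /avoid_prob.
have -> : avoids n.+1 `&` Z n.+1 @^-1` [set y] = avoids n `&` Z n.+1 @^-1` [set y].
  apply/seteqP; split=> w [Aw /= Zy]; split=> // i.
    by move=> /leqW; exact: Aw.
  by rewrite leq_eqVlt => /orP[/eqP->|/Aw//]; rewrite Zy; apply/eqP.
rewrite (prob_partition (X := Z n)); last 2 first.
- by apply: measurableI; [exact: measurable_avoids|exact: measurable_walk].
- by move=> x; exact: measurable_walk.
by apply: eq_bigr => x _; rewrite setIAC prob_step.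
Qed.

Variable h : V -> R.
Hypotheses (h_ge0 : forall x, 0 <= h x) (hv : h v = 0).
Hypothesis h_step : forall x, x != v -> \sum_y srw_step R e x y * h y = h x - 1.

(** The expectation of h(Z_n) on the event T_v > n. *)
Let S n := \sum_x avoid_prob n x * h x.

Let S0 : S 0 = h u.
Proof.
rewrite /S (bigD1 u) //= big1 ?addr0 => [|x xu].
  have [->|uv] := eqVneq u v; first by rewrite hv mulr0.
  by rewrite avoid_prob0 // eqxx mul1r.
have [->|xv] := eqVneq x v; first by rewrite hv mulr0.
by rewrite avoid_prob0 // (negbTE xu) mul0r.
Qed.

Let S_rec n : S n.+1 = S n - prob (avoids n).
Proof.
transitivity (\sum_y \sum_x avoid_prob n x * (srw_step R e x y * h y)).
  apply: eq_bigr => y _; have [->|yv] := eqVneq y v.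
    by rewrite hv mulr0 big1 // => x _; rewrite !mulr0.
  by rewrite avoid_probS // mulr_suml; apply: eq_bigr => x _; rewrite mulrA.
rewrite exchange_big /= prob_avoids -sumrB; apply: eq_bigr => x _.
rewrite -mulr_sumr; have [->|xv] := eqVneq x v.
  by rewrite avoid_prob_target !mul0r subr0.
by rewrite h_step // mulrBr mulr1.
Qed.

Let partial_sum n : \sum_(0 <= i < n) prob (avoids i) = h u - S n.
Proof.
elim: n => [|n IHn]; first by rewrite big_geq // S0 subrr.
by rewrite big_nat_recr //= IHn S_rec; ring.
Qed.

Let S_ge0 n : 0 <= S n.
Proof. by apply: sumr_ge0 => x _; rewrite mulr_ge0 ?prob_ge0. Qed.

(** The partial sums of P(T_v > n) are bounded by [h u], so these probabilities tend to 0; [S n] is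
    at most such a probability times the finite sum of [h], so it tends to 0 as well. *)
Let cvg_partial_sum : (fun n => h u - S n) @ \oo --> h u.
Proof.
have cvg_prob : (fun n => prob (avoids n)) @ \oo --> 0.
  apply: cvg_series_cvg_0; apply: nondecreasing_is_cvgn.
    by apply: nondecreasing_series => n _ _; exact: prob_ge0.
  exists (h u) => _ [n _ <-]; rewrite /series /= partial_sum.
  by rewrite lerBlDr lerDl.
have cvgS : S n @[n --> \oo] --> 0.
  apply: (@squeeze_cvgr _ _ _ _ (fun=> 0) (fun n => prob (avoids n) * \sum_x h x)).
  - near=> n; rewrite S_ge0 /= mulr_sumr; apply: ler_sum => x _.
    apply: ler_wpM2r => //; apply: prob_le; last by move=> w [].
      exact: measurable_avoidsI.
    exact: measurable_avoids.
  - exact: cvg_cst.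
  - by rewrite -[X in _ --> X](mul0r (\sum_x h x)); apply: cvgMl.
by rewrite -[X in _ --> X]subr0; apply: cvgB => //; exact: cvg_cst.
Unshelve. all: by end_near. Qed.

(** A first visit at time [n] makes exactly the terms 0 to n - 1 equal to 1; if [v] is never hit,
    all terms are 1 and both sides are infinite. *)
Lemma hitting_time_series w :
  hitting_time R Z v w = (\sum_(n <oo) (\1_(avoids n) w)%:E)%E.
Proof.
have [[n0 Zn0]|nhit] := pselect (exists n, Z n w = v); last first.
  have av n : (\1_(avoids n) w)%:E = 1%E :> \bar R.
    rewrite indicE mem_set // => i _ Zi; apply: nhit; by exists i.
  rewrite /hitting_time (_ : [set n : nat | Z n w = v] = set0); last first.
    by apply/seteqP; split=> // n Zn; apply: nhit; exists n.
  rewrite image_set0 ereal_inf0; apply/esym/eqyP => A A_gt0.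
  have [M AM] : exists M : nat, A <= M%:R.
    by exists (Num.bound A); rewrite ltW // archi_boundP // ltW.
  apply: le_trans (nneseries_lim_ge M _); last by move=> n _ _; rewrite av.
  under eq_bigr do rewrite av.
  by rewrite sumEFin lee_fin sumr_const_nat subn0.
have [n /eqP Zn n_min] := ex_minnP (ex_intro (fun n => Z n w == v) n0 (introT eqP Zn0)).
have avE i : (\1_(avoids i) w)%:E = ((i < n)%N%:R)%:E :> \bar R.
  rewrite indicE; have [i_lt|n_le] := ltnP i n.
    rewrite mem_set // => j ji Zj; have := n_min j (introT eqP Zj).
    by rewrite leqNgt (leq_ltn_trans ji i_lt).
  by rewrite memNset // => /(_ n n_le).
rewrite (nneseries_split 0 n); last by move=> k _; rewrite avE lee_fin ler0n.
rewrite eseries0 => [|i n_le _]; last by rewrite avE ltnNge n_le.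
rewrite adde0 add0n; apply/eqP; rewrite eq_le; apply/andP.
rewrite (eq_big_nat _ _ (F2 := fun=> 1%E)); last by move=> i /= i_lt; rewrite avE i_lt.
rewrite sumEFin sumr_const_nat subn0; split.
  by apply: ereal_inf_lbound; exists n.
apply: le_ereal_inf_tmp => _ [i /= Zi <-]; rewrite lee_fin ler_nat.
by apply: n_min; apply/eqP.
Qed.

Lemma expected_hitting_timeE : expected_hitting_time P Z v = (h u)%:E.
Proof.
rewrite /expected_hitting_time.
under eq_integral do rewrite hitting_time_series.
rewrite integral_nneseries //; last first.
  (* Integral and sum are exchanged for nonnegative measurable terms. *)
  by move=> n; apply/measurable_EFinP; exact: measurable_indic (measurable_avoids n).
have intE n : (\int[P]_w (\1_(avoids n) w)%:E = (prob (avoids n))%:E)%E.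
  have mA := measurable_avoids n.
  by rewrite (integral_indic P measurableT mA) setIT; exact: probE.
under eq_eseriesr do rewrite intE.
apply: cvg_lim => //; apply: cvg_EFin; first by apply: nearW => n; rewrite sumEFin.
under eq_fun => n do rewrite /= sumEFin /= partial_sum.
exact: cvg_partial_sum.
Qed.

End HittingTime.

(** * Potentials on the product *)

Section LaplacianGreen.
Variables (R : realFieldType) (V : finType) (e : rel V).
Hypotheses (e_sym : symmetric e) (e_conn : connected_graph e).

Lemma sum_laplacian0 (f : V -> R) : \sum_u \sum_(v | e u v) (f u - f v) = 0.
Proof.
have := sum_laplacian_sym e_sym (fun=> 1) f.
under eq_bigr do rewrite mul1r.
by move=> ->; apply: big1 => u _; rewrite big1 ?mul0r // => v _; rewrite subrr.
Qed.

(** Adding the all-ones matrix [J] to the singular Laplacian makes it invertible. In a solution of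
    [w *m L = delta], the [J] term is the constant 1/|V|, which moves to the right-hand side. *)
Lemma laplacian_green r (o : V) : regular_graph e r ->
  exists g : V -> R, forall u,
    \sum_(v | e u v) (g u - g v) = (u == o)%:R - (#|V|%:R)^-1.
Proof.
move=> e_reg; pose J : 'M[R]_#|V| := const_mx 1.
pose L := laplacian R e r + J.
have V0 : #|V|%:R != 0 :> R by rewrite pnatr_eq0 -lt0n; apply/card_gt0P; exists o.
have mulJ (w : 'rV[R]_#|V|) j : (w *m J) 0 j = \sum_u w 0 (enum_rank u).
  rewrite mxE (reindex enum_rank) /=; last by apply: onW_bij; exact: enum_rank_bij.
  by apply: eq_bigr => u _; rewrite mxE mulr1.
have mulL (w : 'rV[R]_#|V|) u : (w *m L) 0 (enum_rank u) =
    \sum_(v | e u v) (w 0 (enum_rank u) - w 0 (enum_rank v))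
    + \sum_v w 0 (enum_rank v).
  rewrite -(mul_laplacian e_sym e_reg w 0 u) -(mulJ w (enum_rank u)).
  by rewrite mulmxDr [LHS]mxE.
have sumL (w : 'rV[R]_#|V|) : \sum_u (w *m L) 0 (enum_rank u) =
    #|V|%:R * \sum_u w 0 (enum_rank u).
  under eq_bigr do rewrite mulL.
  by rewrite big_split /= sum_laplacian0 add0r sumr_const mulr_natl.
(* A kernel vector has sum 0 by [sumL], hence is harmonic, hence constant, hence 0. *)
have L_unit : L \in unitmx.
  rewrite -row_free_unit -kermx_eq0; apply/eqP/row_matrixP => i; rewrite row0.
  set w := row i _; have wL : w *m L = 0.
    by apply/sub_kermxP; exact: row_sub.
  clearbody w; have s0 : \sum_u w 0 (enum_rank u) = 0.
    apply/eqP; have /eqP := sumL w; rewrite wL big1 => [|u _]; last by rewrite mxE.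
    by rewrite eq_sym mulf_eq0 (negbTE V0).
  have wC u v : w 0 (enum_rank u) = w 0 (enum_rank v).
    apply: (harmonic_const (f := fun u => w 0 (enum_rank u)) e_conn) => x.
    by have := mulL w x; rewrite wL s0 addr0 mxE.
  apply/rowP => j; rewrite mxE -(enum_valK j); apply/eqP; move/eqP: s0.
  rewrite (eq_bigr (fun=> w 0 (enum_rank (enum_val j)))) => [|u _]; last exact: wC.
  by rewrite sumr_const -[w _ _ *+ _]mulr_natl mulf_eq0 (negbTE V0).
pose w : 'rV[R]_#|V| := delta_mx 0 (enum_rank o) *m invmx L.
have wL : w *m L = delta_mx 0 (enum_rank o) by rewrite /w mulmxKV.
clearbody w; exists (fun u => w 0 (enum_rank u)) => u.
have sw : \sum_v w 0 (enum_rank v) = (#|V|%:R)^-1.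
  apply: (mulfI V0); rewrite mulfV // -sumL wL (bigD1 o) //= mxE !eqxx big1 ?addr0 //.
  by move=> v vo; rewrite mxE (inj_eq enum_rank_inj) (negbTE vo) andbF.
have := mulL w u; rewrite wL sw mxE eqxx (inj_eq enum_rank_inj) andTb => ->.
by rewrite addrK.
Qed.

End LaplacianGreen.

(** * Hitting times on the circulant graph from its Green function *)

Section CirculantHitting.
Variables (R : realType) (N k : nat).
Hypotheses (k_gt0 : (0 < k)%N) (N_ge : (k.*2.+1 <= N)%N).
Let N_gt1 := circ_order_gt1 k_gt0 N_ge.

Lemma sum_circ_graphB (K : zmodType) (f : 'Z_N -> K) (x y : 'Z_N) :
  \sum_(z | circ_graph N k x z) (f (x - y) - f (z - y)) =
  \sum_(z | circ_graph N k (x - y) z) (f (x - y) - f z).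
Proof.
by rewrite !sum_circ_graph //; apply: eq_bigr => s _; rewrite ![x - y + _]addrAC.
Qed.

Lemma circ_green : exists g : 'Z_N -> R,
  (forall x, \sum_(y | circ_graph N k x y) (g x - g y) = (x == 0)%:R - (N%:R)^-1) /\
  (forall x, g (- x) = g x).
Proof.
have [g gE0] := laplacian_green R (@circ_graph_sym N k)
  (circ_graph_connected (N := N) k_gt0) 0 (circ_graph_regular k_gt0 N_ge).
have gE x : \sum_(y | circ_graph N k x y) (g x - g y) = (x == 0)%:R - (N%:R)^-1.
  by rewrite gE0 card_ord [X in X%:R^-1](Zp_cast N_gt1).
exists g; split=> // x.
(* Evenness of [g]: this odd part is harmonic, hence constant, and it vanishes at 0. *)
pose f x := g x - g (- x).
suff /(_ x 0) : forall u v, f u = f v.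
  by rewrite /f oppr0 subrr => /eqP; rewrite subr_eq0 eq_sym => /eqP.
apply: (harmonic_const (circ_graph_connected (N := N) k_gt0)) => y.
have gN : \sum_(z | circ_graph N k y z) (g (- y) - g (- z)) =
    \sum_(z | circ_graph N k (- y) z) (g (- y) - g z).
  rewrite !sum_circ_graph //; apply: eq_bigr => s _.
  by rewrite !opprD opprK addrC.
rewrite (eq_bigr (fun z => (g y - g z) - (g (- y) - g (- z)))) => [|z _]; last first.
  by rewrite /f; ring.
by rewrite sumrB gN !gE oppr_eq0 subrr.
Qed.

Variable g : 'Z_N -> R.
Hypothesis gE : forall x,
  \sum_(y | circ_graph N k x y) (g x - g y) = (x == 0)%:R - (N%:R)^-1.

(** Away from [z], the Laplacian of g(0) - g(x - z) is 1/N, while a hitting time needs the degree 2k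
    there; hence the factor 2kN. *)
Definition circ_hitting (z x : 'Z_N) : R := (k.*2 * N)%:R * (g 0 - g (x - z)).

Lemma circ_hitting_target z : circ_hitting z z = 0.
Proof. by rewrite /circ_hitting !subrr mulr0. Qed.

Lemma laplacian_circ_hitting z x : x != z ->
  \sum_(y | circ_graph N k x y) (circ_hitting z x - circ_hitting z y) = (k.*2)%:R.
Proof.
move=> xz; have N0 : N%:R != 0 :> R by rewrite pnatr_eq0 -lt0n ltnW.
transitivity (- (k.*2 * N)%:R * \sum_(y | circ_graph N k x y) (g (x - z) - g (y - z))).
  by rewrite mulr_sumr; apply: eq_bigr => y _; rewrite /circ_hitting; ring.
by rewrite sum_circ_graphB gE subr_eq0 (negbTE xz) natrM sub0r mulrNN mulfK.
Qed.

Lemma circ_hitting_step z x : x != z ->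
  \sum_y srw_step R (circ_graph N k) x y * circ_hitting z y = circ_hitting z x - 1.
Proof.
move=> xz; have k0 : (k.*2)%:R != 0 :> R by rewrite pnatr_eq0 double_eq0 -lt0n.
have dx := circ_graph_regular k_gt0 N_ge x.
have LE := laplacian_circ_hitting xz.
rewrite sumrB sumr_const (_ : #|_| = k.*2) // -[circ_hitting z x *+ _]mulr_natl in LE.
apply: (mulfI k0); rewrite [RHS]mulrBr mulr1 -[X in _ = _ - X]LE subKr mulr_sumr.
rewrite [RHS]big_mkcond /=.
apply: eq_bigr => y _; rewrite /srw_step dx.
by case: circ_graph; rewrite ?mul0r ?mulr0 // mul1r mulrA divff // mul1r.
Qed.

(** At a minimum the Laplacian is at most 0, but it is 2k > 0 away from [z]; so the minimum is the
    value 0 at [z]. *)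
Lemma circ_hitting_ge0 z x : 0 <= circ_hitting z x.
Proof.
case: (@arg_minP _ _ _ x xpredT (circ_hitting z) isT) => y _ miny.
apply: le_trans (miny x isT).
have [->|yz] := eqVneq y z; first by rewrite circ_hitting_target.
have := laplacian_circ_hitting yz; have : 0 < (k.*2)%:R :> R by rewrite ltr0n double_gt0.
move=> kp kE; move: kp; rewrite -kE ltNge sumr_le0 // => w _.
by rewrite subr_le0; exact: miny.
Qed.

End CirculantHitting.

Section ProductPotential.
Variables (C : comNzRingType) (U V : finType) (e : rel U) (f : rel V) (t : nat).
Hypothesis f_irr : irreflexive f.
Variables (nu : 'I_t -> C) (E : 'I_t -> V -> C) (p : 'I_t -> U -> C) (x y : U) (a : V).
Hypothesis pE : forall i z,
  \sum_(w | e z w) (p i z - p i w) + nu i * p i z = (z == x)%:R - (z == y)%:R.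
Hypothesis EE : forall i b, \sum_(c | f b c) (E i b - E i c) = nu i * E i b.
Hypothesis sumE : forall b, \sum_i E i b = (b == a)%:R.

(** Separation of variables: on the [i]-th term the Laplacian of the second factor acts as the
    scalar [nu i], which completes the equation for [p i]; then [sumE] localises at [a]. *)
Lemma product_potential (u : U * V) :
  \sum_(v | cart_prod e f u v)
     (\sum_i E i u.2 * p i u.1 - \sum_i E i v.2 * p i v.1) =
  (u == (x, a))%:R - (u == (y, a))%:R.
Proof.
case: u => z b; rewrite sum_cart_prod //=.
transitivity (\sum_i E i b * (\sum_(w | e z w) (p i z - p i w) + nu i * p i z)).
  under eq_bigr do rewrite -sumrB.
  under [X in _ + X]eq_bigr do rewrite -sumrB.
  rewrite exchange_big [X in _ + X]exchange_big -big_split /=; apply: eq_bigr => i _.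
  rewrite mulrDr mulr_sumr mulrCA mulrA -EE mulr_suml; congr (_ + _).
    by apply: eq_bigr => w _; rewrite mulrBr.
  by apply: eq_bigr => w _; rewrite mulrBl.
under eq_bigr do rewrite pE.
rewrite -mulr_suml sumE !xpair_eqE.
by case: (b == a); rewrite ?andbT ?andbF ?mul1r ?mul0r ?subrr.
Qed.

End ProductPotential.

(** * Potentials on the circulant graph for a positive eigenvalue *)

Section CirculantPotential.
Variables (C : numClosedFieldType) (N k : nat).
Hypotheses (k_gt0 : (0 < k)%N) (N_ge : (k.*2.+1 <= N)%N).
Variables (nu : C) (phi rho eta : 'I_k -> C).
Hypotheses (nu_gt0 : 0 < nu) (D_simple : simple_roots (Dpoly k nu)).
Hypotheses (phi_inj : injective phi).
Hypothesis (phi_roots : forall z, root (Dpoly k nu) z <-> exists c, z = phi c).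
Hypotheses (rho_neq0 : forall c, rho c != 0).
Hypothesis (rho_phi : forall c, rho c + (rho c)^-1 = phi c).
Hypothesis (eta_rho : forall c, eta c ^+ 2 = rho c).
Let W : 'Z_N -> C := circ_resolvent nu phi rho.

Let root_phi c : root (Dpoly k nu) (phi c).
Proof. by apply/phi_roots; exists c. Qed.

Let rho_not_unity c M : rho c ^+ M.+1 != 1.
Proof.
apply/eqP => /(Dpoly_unit_root_neq0 k nu_gt0); rewrite rho_phi.
by have /rootP-> := root_phi c; rewrite eqxx.
Qed.

Let deriv_phi c : (Dpoly k nu)^`().[phi c] != 0.
Proof.
apply: simple_root_deriv_neq0 => //; last exact: D_simple.
(* D does not vanish at 2 = 1 + 1^-1, so it is not the zero polynomial. *)
have := Dpoly_unit_root_neq0 k nu_gt0 (expr1n C 1).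
by apply: contraNneq => ->; rewrite horner0.
Qed.

Let N_pred : N = N.-1.+1.
Proof. by rewrite prednK // (leq_trans _ N_ge). Qed.

(** The factor 1/2 compensates the right-hand side 2 in the equation of the resolvent. *)
Definition circ_potential (y x : 'Z_N) : C := 2^-1 * (W x - W (x - y)).

Lemma circ_potentialE y x :
  \sum_(z | circ_graph N k x z) (circ_potential y x - circ_potential y z)
  + nu * circ_potential y x = (x == 0)%:R - (x == y)%:R.
Proof.
have two0 : 2 != 0 :> C by rewrite pnatr_eq0.
have rN c : rho c ^+ N != 1 by rewrite N_pred.
have WE := circ_resolventE two0 k_gt0 N_ge phi_inj root_phi deriv_phi rho_neq0
  rho_phi (fun c => rho_not_unity c 1) rN.
transitivity (2^-1 * (\sum_(z | circ_graph N k x z) (W x - W z) + nu * W x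
  - (\sum_(z | circ_graph N k x z) (W (x - y) - W (z - y)) + nu * W (x - y)))).
  rewrite opprD addrACA -sumrB -mulrBr mulrDr mulr_sumr; congr (_ + _).
    by apply: eq_bigr => z _; rewrite /circ_potential; ring.
  by rewrite /circ_potential; ring.
by rewrite sum_circ_graphB // !WE // -mulrBr mulKf // subr_eq0.
Qed.

Lemma circ_potential_diff l : (l < N)%N ->
  circ_potential l%:R 0 - circ_potential l%:R l%:R =
  - \sum_c ((eta c + (eta c)^-1) * (Dpoly k nu)^`().[phi c])^-1 *
      (Vseq (eta c + (eta c)^-1) l * Vseq (eta c + (eta c)^-1) (N - l)
         / Vseq (eta c + (eta c)^-1) N).
Proof.
move=> lN; have two0 : 2 != 0 :> C by rewrite pnatr_eq0.
have N_gt1 := circ_order_gt1 k_gt0 N_ge.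
rewrite /circ_potential sub0r subrr /W circ_resolvent_sym // -/W.
(* Since [W] is even, the two halves of the difference agree. *)
transitivity (W 0 - W l%:R); first by field.
rewrite -sumrB -sumrN; apply: eq_bigr => c _; rewrite -mulrBr.
rewrite val_Zp_nat // modn_small // -eta_rho.
have eta0 : eta c != 0 by have := rho_neq0 c; rewrite -eta_rho expf_eq0.
rewrite [X in X - _](_ : _ = cycle_green N (eta c ^+ 2) 0) //.
rewrite cycle_green_diff // ?(ltnW lN) //; last 2 first.
- by rewrite eta_rho rho_not_unity.
- by rewrite eta_rho N_pred.
by rewrite invfM mulrN mulrCA !mulrA.
Qed.

End CirculantPotential.

Theorem corollary5p8 (R : realType) (N k : nat) (k_gt0 : (0 < k)%N)
  (N_ge : (k.*2.+1 <= N)%N)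
  (V : finType) (e : rel V) (r m : nat)
  (e_sym : symmetric e) (e_irr : irreflexive e)
  (e_conn : connected_graph e) (e_reg : regular_graph e r) (card_V : #|V| = m)
  (t : nat) (nu : 'I_t.+1 -> R)
  (nu0 : nu ord0 = 0)
  (nu_incr : forall i j : 'I_t.+1, (i < j)%N -> nu i < nu j)
  (nu_spec : forall x : R,
     eigenvalue (laplacian R e r) x <-> exists i : 'I_t.+1, x = nu i)
  (D_simple : forall alpha : 'I_t.+1, alpha != ord0 ->
     simple_roots (Dpoly k (nu alpha)%:C%C))
  (phi rho eta : 'I_t.+1 -> 'I_k -> R[i])
  (phi_inj : forall alpha : 'I_t.+1, alpha != ord0 -> injective (phi alpha))
  (phi_roots : forall alpha : 'I_t.+1, alpha != ord0 -> forall z : R[i],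
     root (Dpoly k (nu alpha)%:C%C) z <-> exists c : 'I_k, z = phi alpha c)
  (rho_neq0 : forall (alpha : 'I_t.+1) (c : 'I_k), alpha != ord0 ->
     rho alpha c != 0)
  (rho_phi : forall (alpha : 'I_t.+1) (c : 'I_k), alpha != ord0 ->
     rho alpha c + (rho alpha c)^-1 = phi alpha c)
  (eta_rho : forall (alpha : 'I_t.+1) (c : 'I_k), alpha != ord0 ->
     eta alpha c ^+ 2 = rho alpha c)
  (a : V) (l : nat) (l_ge1 : (1 <= l)%N) (l_le : (l <= N - 1)%N)
  (d : measure_display) (Omega : measurableType d) (P : probability Omega R)
  (Z : nat -> Omega -> 'Z_N)
  (Z_srw : simple_random_walk P (circ_graph N k) 0 Z) :
  let X := cart_prod (circ_graph N k) e in
  let tau : R[i] := (num_spanning_trees X)%:R in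
  let h := expected_hitting_time P Z (l%:R : 'Z_N) in
  let E (alpha : 'I_t.+1) (x y : V) : R :=
    eigenproj (laplacian R e r) (nu alpha) (enum_rank x) (enum_rank y) in
  let gamma (alpha : 'I_t.+1) (c : 'I_k) : R[i] :=
    eta alpha c + (eta alpha c)^-1 in
  (num_separating_2forests X (0, a) (l%:R, a))%:R =
    tau / (N * m * k)%:R * (fine h)%:C%C
    - tau * \sum_(alpha : 'I_t.+1 | alpha != ord0)
        (E alpha a a)%:C%C *
        \sum_(c : 'I_k)
          (gamma alpha c * (Dpoly k (nu alpha)%:C%C)^`().[phi alpha c])^-1 *
          (Vseq (gamma alpha c) l * Vseq (gamma alpha c) (N - l)
             / Vseq (gamma alpha c) N).
Proof.
move=> X tau h E gamma.
have N_gt1 := circ_order_gt1 k_gt0 N_ge.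
have lN : (l < N)%N by move: l_le N_gt1; lia.
have k0 : k%:R != 0 :> R[i] by rewrite pnatr_eq0 -lt0n.
have N0 : N%:R != 0 :> R[i] by rewrite pnatr_eq0 -lt0n ltnW.
have m0 : m%:R != 0 :> R[i].
  by rewrite -card_V pnatr_eq0 -lt0n; apply/card_gt0P; exists a.
have nu_inj : injective nu.
  move=> i j Eij; apply/val_inj/eqP; case: ltngtP => // /nu_incr;
    by rewrite Eij ltxx.
have nu_gt0 i : i != ord0 -> 0 < (nu i)%:C%C.
  by move=> i0; rewrite ltcR -nu0 nu_incr // lt0n.
have nu_ex x : eigenvalue (laplacian R e r) x -> exists i, x = nu i by move/nu_spec.
have [g [gE g_sym]] := circ_green R k_gt0 N_ge.
have hE : h = (circ_hitting k g l%:R 0)%:E.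
  apply: (expected_hitting_timeE Z_srw); first exact: circ_hitting_ge0.
    exact: circ_hitting_target.
  exact: circ_hitting_step.
(* For the eigenvalue 0 the Laplacian has no inverse; the constant terms 1/N cancel in the
   difference of two translates of [g]. *)
pose p i x : R[i] := if i == ord0 then (g x - g (x - l%:R))%:C%C
  else circ_potential (nu i)%:C%C (phi i) (rho i) l%:R x.
have pE i z : \sum_(w | circ_graph N k z w) (p i z - p i w) + (nu i)%:C%C * p i z
    = (z == 0)%:R - (z == l%:R)%:R.
  rewrite /p; have [->|i0] := eqVneq i ord0.
    rewrite nu0 mul0r addr0.
    transitivity ((\sum_(w | circ_graph N k z w) (g z - g w)
      - \sum_(w | circ_graph N k z w) (g (z - l%:R) - g (w - l%:R)))%:C%C).
      rewrite -sumrB rmorph_sum /=; apply: eq_bigr => w _.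
      by rewrite -rmorphB; congr (_%:C%C); ring.
    rewrite sum_circ_graphB // !gE subr_eq0 opprB addrA subrK rmorphB.
    by rewrite !rmorph_nat.
  by apply: circ_potentialE; auto.
pose F i b : R[i] := (spectral_entry e r nu i a b)%:C%C.
have FE i b : \sum_(c | e b c) (F i b - F i c) = (nu i)%:C%C * F i b.
  rewrite -rmorphM -(laplacian_spectral_entry e_sym e_reg) rmorph_sum.
  by apply: eq_bigr => c _; rewrite rmorphB.
have sumF b : \sum_i F i b = (b == a)%:R.
  by rewrite -rmorph_sum sum_spectral_entry // rmorph_nat eq_sym.
have X_sym : symmetric X by apply: cart_prod_sym => //; exact: circ_graph_sym.
have X_irr : irreflexive X by apply: cart_prod_irr => //; exact: circ_graph_irr.
have potE := product_potential e_irr pE FE sumF.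
rewrite (num_separating_2forests_potential X_sym X_irr potE) /= -/tau -sumrB.
rewrite -mulrA -mulrBr; congr (tau * _).
rewrite (bigD1 ord0) //=; congr (_ + _).
  (* Here E_0(a, a) = 1/m and h = 2kN (g(0) - g(l)) by evenness, so both sides are 2 (g(0) - g(l)) /
     m. *)
  rewrite -mulrBr /p eqxx /F spectral_entry0 // card_V hE /= /circ_hitting.
  rewrite !sub0r !subrr g_sym !natrM -mul2n natrM.
  rewrite !(rmorphM, rmorphB, rmorph_nat, fmorphV) /=.
  by field; rewrite k0 N0 m0.
rewrite -sumrN; apply: eq_bigr => i i0; rewrite -mulrBr /p (negbTE i0) -[RHS]mulrN.
congr (_ * _); apply: circ_potential_diff; auto.
Qed.
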